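(* Let $(\mathcal E,\mathcal L,\mathcal B)$ be a weakly left-resolving labelled space such that $\mathcal B$ is closed under relative complements. Then there exists a homeomorphism between the tight spectrum $\mathsf T$ (the space of tight filters in $E(S)$) and the spectrum $\widehat\Delta$ of the diagonal C*-algebra $\Delta=\Delta(\mathcal E,\mathcal L,\mathcal B)$.
   Context: A directed graph $\mathcal E=(\mathcal E^0,\mathcal E^1,r,s)$ consists of non-empty sets of vertices and edges with range and source maps $r,s:\mathcal E^1\to\mathcal E^0$. A path is a finite or infinite sequence of edges $\lambda_1\lambda_2\cdots$ with $r(\lambda_i)=s(\lambda_{i+1})$; for finite $\lambda=\lambda_1\cdots\lambda_n$, $s(\lambda)=s(\lambda_1)$, $r(\lambda)=r(\lambda_n)$. Put $\mathcal E^0_{sink}=\{v:s^{-1}(v)=\emptyset\}$. A labelled graph $(\mathcal E,\mathcal L)$ is a graph with a surjective map $\mathcal L:\mathcal E^1\to\mathcal A$ onto a non-empty alphabet $\mathcal A$, extended letterwise to paths. $\mathcal L^{\ge 1}$ is the set of labels of finite paths of length at least $1$; $\mathcal L^*=\{\omega\}\cup\mathcal L^{\ge1}$ with $\omega$ the empty word. For $A\subseteq\mathcal E^0$ and $\alpha\in\mathcal L^{\ge1}$, $r(A,\alpha)=\{r(\lambda):\mathcal L(\lambda)=\alpha,\ s(\lambda)\in A\}$; $r(A,\omega)=A$; $r(\alpha)=r(\mathcal E^0,\alpha)$; $\mathcal L(A\mathcal E^1)=\{\mathcal L(e):e\in\mathcal E^1,\ s(e)\in A\}$. A labelled space $(\mathcal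 E,\mathcal L,\mathcal B)$ is a labelled graph with a family $\mathcal B$ of subsets of $\mathcal E^0$ that is accommodating: closed under finite intersections and finite unions, containing $r(\alpha)$ for all $\alpha\in\mathcal L^{\ge1}$, and with $r(A,\alpha)\in\mathcal B$ for all $A\in\mathcal B$, $\alpha\in\mathcal L^*$. It is weakly left-resolving if $r(A\cap B,\alpha)=r(A,\alpha)\cap r(B,\alpha)$ for all $A,B\in\mathcal B$, $\alpha\in\mathcal L^{\ge1}$. Closed under relative complements means $A\setminus B\in\mathcal B$ for $A,B\in\mathcal B$. For $\alpha\in\mathcal L^*$, $\mathcal B_\alpha=\{A\in\mathcal B:A\subseteq r(\alpha)\}$ (so $\mathcal B_\omega=\mathcal B$). $S=\{(\alpha,A,\beta):\alpha,\beta\in\mathcal L^*,\ A\in\mathcal B_\alpha\cap\mathcal B_\beta,\ A\ne\emptyset\}\cup\{0\}$ is an inverse semigroup whose idempotents are $E(S)=\{(\alpha,A,\alpha):\alpha\in\mathcal L^*,\ \emptyset\neq A\in\mathcal B_\alpha\}\cup\{0\}$. On $E(S)$ the product, for $p=(\alpha,A,\alpha)$ and $q=(\beta,B,\beta)$, is $pq=qp=(\beta,r(A,\beta')\cap B,\beta)$ if $\beta=\alpha\beta'$ and $r(A,\beta')\cap B\neq\emptyset$; $pq=(\alpha,A\cap r(B,\alpha'),\alpha)$ if $\alpha=\beta\alpha'$ and $A\cap r(B,\alpha')\ne\emptyset$; and $0$ otherwise. $E(S)$ is a meet semilattice with $0$ with order $p\le q\iff pq=p$ (for non-zero $p,q$: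 $\alpha=\beta\alpha'$ and $A\subseteq r(B,\alpha')$). A filter in a meet semilattice $E$ with $0$ is a non-empty $\xi\subseteq E$ with $0\notin\xi$, closed upwards and under meets. For $x\in E$, a set $Z\subseteq\{y:y\le x\}$ is a cover for $x$ if every non-zero $y\le x$ has some $z\in Z$ with $z\wedge y\ne0$. A filter $\xi$ is tight if for every $x\in E$ and every finite cover $Z$ for $x$, $x\in\xi$ if and only if $Z\cap\xi\neq\emptyset$. $\mathsf T$ is the set of tight filters in $E(S)$ with the topology of pointwise convergence of indicator functions (a net $\xi_\lambda\to\xi$ iff for each $x\in E(S)$, eventually $x\in\xi_\lambda\Leftrightarrow x\in\xi$). $C^*(\mathcal E,\mathcal L,\mathcal B)$ is the universal C*-algebra generated by projections $\{p_A:A\in\mathcal B\}$ and partial isometries $\{s_a:a\in\mathcal A\}$ subject to: (i) $p_{A\cap B}=p_Ap_B$, $p_{A\cup B}=p_A+p_B-p_{A\cap B}$, $p_\emptyset=0$ for $A,B\in\mathcal B$; (ii) $p_As_a=s_ap_{r(A,a)}$ for $A\in\mathcal B$, $a\in\mathcal A$; (iii) $s_a^*s_a=p_{r(a)}$ and $s_b^*s_a=0$ if $b\ne a$; (iv) for every $A\in\mathcal B$ with $0<\#\mathcal L(A\mathcal E^1)<\infty$ and for which there is no $B\in\mathcal B$ with $\emptyset\ne B\subseteq A\cap\mathcal E^0_{sink}$, $p_A=\sum_{a\in\mathcal L(A\mathcal E^1)}s_ap_{r(A,a)}s_a^*$. For a word $\alpha=a_1\cdots a_n$, $s_\alpha=s_{a_1}\cdots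 s_{a_n}$; $s_\omega=1$ is a formal unit ($s_\omega p_As_\omega^*$ means $p_A$). The diagonal C*-algebra $\Delta(\mathcal E,\mathcal L,\mathcal B)$ is the C*-subalgebra of $C^*(\mathcal E,\mathcal L,\mathcal B)$ generated by $\{s_\alpha p_As_\alpha^*:\alpha\in\mathcal L^*,\ A\in\mathcal B_\alpha\}$; it is commutative, and $\widehat\Delta$ is its spectrum (non-zero *-homomorphisms to $\mathbb C$, with the topology of pointwise convergence). *)

(* Defs.v *)
From HB Require Import structures.
From mathcomp Require Import all_boot all_order all_algebra complex.
From mathcomp Require Import all_classical all_reals.
From mathcomp Require Import topology normedtype.

Set Implicit Arguments.
Unset Strict Implicit.
Unset Printing Implicit Defensive.

Import Order.TTheory GRing.Theory Num.Theory.
Import numFieldNormedType.Exports.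

Local Open Scope classical_set_scope.
Local Open Scope complex_scope.
Local Open Scope ring_scope.

Record labelledGraph := LabelledGraph {
  vertex : choiceType;
  edge : choiceType;
  alphabet : choiceType;
  rng : edge -> vertex;
  src : edge -> vertex;
  lab : edge -> alphabet;
  vertex_inhabited : inhabited vertex;
  edge_inhabited : inhabited edge;
  lab_surjective : forall a, exists e, lab e = a
}.

Section LabelledGraphTheory.
Variable G : labelledGraph.

Definition sinks : set (vertex G) := [set v | forall e : edge G, src e != v].

(* The path of positive length with edges [e :: l]. *)
Definition is_path (e : edge G) (l : seq (edge G)) : bool :=
  path [rel e1 e2 | rng e1 == src e2] e l.

Definition labels1 : set (seq (alphabet G)) :=
  [set alpha | exists e l, is_path e l /\ [seq lab f | f <- e :: l] = alpha].

Definition labels : set (seq (alphabet G)) := [set [::]] `|` labels1.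

Definition rrange (A : set (vertex G)) (alpha : seq (alphabet G)) :
    set (vertex G) :=
  if alpha is [::] then A else
  [set v | exists e l, [/\ is_path e l, [seq lab f | f <- e :: l] = alpha,
                           A (src e) & v = rng (last e l)]].

(* r(alpha); the empty word gives the set of all vertices, so that
   [lsets_below L [::]] below is the whole family. *)
Definition wrange (alpha : seq (alphabet G)) : set (vertex G) :=
  rrange setT alpha.

Definition out_labels (A : set (vertex G)) : set (alphabet G) :=
  [set lab e | e in [set e | A (src e)]].

Definition accommodating (B : set_system (vertex G)) : Prop :=
  [/\ setI_closed B,
      setU_closed B,
      forall alpha, labels1 alpha -> B (wrange alpha)
    & forall A alpha, B A -> labels alpha -> B (rrange A alpha)].

End LabelledGraphTheory.

Arguments sinks : clear implicits.
Arguments labels1 : clear implicits.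
Arguments labels : clear implicits.

Record labelledSpace := LabelledSpace {
  lgraph :> labelledGraph;
  lsets : set_system (vertex lgraph);
  lsets_accommodating : accommodating lsets
}.

Arguments lsets : clear implicits.
Arguments lsets_accommodating : clear implicits.

Definition weakly_left_resolving (L : labelledSpace) : Prop :=
  forall A1 A2 alpha, lsets L A1 -> lsets L A2 -> labels1 L alpha ->
    rrange (A1 `&` A2) alpha = rrange A1 alpha `&` rrange A2 alpha.

Definition closed_rel_complements (L : labelledSpace) : Prop :=
  forall A1 A2, lsets L A1 -> lsets L A2 -> lsets L (A1 `\` A2).

Definition lsets_below (L : labelledSpace) (alpha : seq (alphabet L)) :
    set_system (vertex L) :=
  [set A | lsets L A /\ A `<=` wrange alpha].

(* The meet semilattice is the subset [E] of the type [X], with bottom element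
   [zero]; [meet] is only meaningful on [E]. *)

Section TightFilters.
Variables (X : Type) (E : set X) (zero : X) (meet : X -> X -> X).

Definition meet_le (x y : X) : Prop := meet x y = x.

Definition is_filter (xi : set X) : Prop :=
  [/\ xi `<=` E, xi !=set0, ~ xi zero,
      forall x y, xi x -> E y -> meet_le x y -> xi y
    & forall x y, xi x -> xi y -> xi (meet x y)].

Definition is_cover (x : X) (Z : set X) : Prop :=
  Z `<=` [set y | E y /\ meet_le y x] /\
  forall y, E y -> meet_le y x -> y <> zero ->
    exists2 z, Z z & meet z y <> zero.

Definition is_tight (xi : set X) : Prop :=
  is_filter xi /\
  forall x Z, E x -> finite_set Z -> is_cover x Z ->
    (xi x <-> Z `&` xi !=set0).

End TightFilters.

Section TightSpectrum.
Variable L : labelledSpace.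

(* [Some (alpha, A)] stands for the idempotent (alpha, A, alpha) of S, and
   [None] for 0. *)
Definition preidem : Type := option (seq (alphabet L) * set (vertex L)).

Definition idem : set preidem :=
  [set x | if x is Some (alpha, A)
           then [/\ labels L alpha, lsets_below alpha A & A !=set0]
           else True].

Definition mk_idem (alpha : seq (alphabet L)) (A : set (vertex L)) : preidem :=
  if `[< A !=set0 >] then Some (alpha, A) else None.

Definition idem_mul (x y : preidem) : preidem :=
  match x, y with
  | Some (alpha, A), Some (beta, B) =>
    if prefix alpha beta then
      mk_idem beta (rrange A (drop (size alpha) beta) `&` B)
    else if prefix beta alpha then
      mk_idem alpha (A `&` rrange B (drop (size beta) alpha))
    else None
  | _, _ => None
  end.

Definition tight_filters : set (set preidem) :=
  [set xi | is_tight idem None idem_mul xi].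

Definition indicator (xi : tight_filters) : {ptws idem -> bool} :=
  fun x => val x \in val xi.

Definition tight_spectrum : topologicalType := initial_topology indicator.

End TightSpectrum.

(* C*-algebras are not assumed to be unital, so that the product cannot be that
   of a MathComp ring.  The norm takes its values in the nonnegative reals of
   [R[i]]. *)

HB.mixin Record isCStarAlgebra (R : realType) A
    & CompleteNormedModule R[i] A := {
  cmul : A -> A -> A;
  star : A -> A;
  cmulA : associative cmul;
  cmulDl : left_distributive cmul +%R;
  cmulDr : right_distributive cmul +%R;
  cmulZl : forall (c : R[i]) x y, cmul (c *: x) y = c *: cmul x y;
  cmulZr : forall (c : R[i]) x y, cmul x (c *: y) = c *: cmul x y;
  starK : involutive star;
  starD : {morph star : x y / x + y};
  starZ : forall (c : R[i]) x, star (c *: x) = Num.conj c *: star x;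
  starM : forall x y, star (cmul x y) = cmul (star y) (star x);
  cnormM : forall x y, `|cmul x y| <= `|x| * `|y|;
  cnorm_star : forall x, `|cmul (star x) x| = `|x| ^+ 2
}.

#[short(type="cstarAlgType")]
HB.structure Definition CStarAlgebra (R : realType) :=
  {A of isCStarAlgebra R A & CompleteNormedModule R[i] A}.

Declare Scope cstar_scope.
Delimit Scope cstar_scope with cstar.
Notation "x ** y" := (cmul x y) (at level 40, left associativity) : cstar_scope.
Local Open Scope cstar_scope.

Section CStarTheory.
Variable R : realType.

Definition projection (A : cstarAlgType R) (x : A) : Prop :=
  star x = x /\ x ** x = x.

Definition partial_isometry (A : cstarAlgType R) (x : A) : Prop :=
  x ** star x ** x = x.

Definition star_hom (A B : cstarAlgType R) (h : A -> B) : Prop :=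
  [/\ forall (c : R[i]) x y, h (c *: x + y) = c *: h x + h y,
      forall x y, h (x ** y) = h x ** h y
    & forall x, h (star x) = star (h x)].

Definition cstar_subalgebra (A : cstarAlgType R) (D : set A) : Prop :=
  [/\ closed D, D 0,
      forall (c : R[i]) x y, D x -> D y -> D (c *: x + y),
      forall x y, D x -> D y -> D (x ** y)
    & forall x, D x -> D (star x)].

Definition cstar_generated (A : cstarAlgType R) (X : set A) : set A :=
  smallest (@cstar_subalgebra A) X.

(* Non-zero *-homomorphisms to the complex numbers.  The C*-subalgebra [D] is
   only given as a subset of [A], so that the operations of [D] are expressed
   through those of [A]. *)
Definition characters (A : cstarAlgType R) (D : set A) :
    set {ptws D -> R[i]^o} :=
  [set chi : {ptws D -> R[i]^o} |
    [/\ exists x, chi x != 0,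
        forall (c : R[i]) (x y z : D),
          val z = c *: val x + val y -> chi z = c * chi x + chi y,
        forall x y z : D, val z = val x ** val y -> chi z = chi x * chi y
      & forall x z : D, val z = star (val x) -> chi z = Num.conj (chi x)]].

Definition spectrum (A : cstarAlgType R) (D : set A) : topologicalType :=
  set_type (@characters A D).

End CStarTheory.

Section LabelledSpaceAlgebra.
Variables (R : realType) (L : labelledSpace).

(* [p] is only constrained on members of the family; [set0] is one as soon as
   the family is closed under relative complements. *)
Definition representation (A : cstarAlgType R)
    (p : set (vertex L) -> A) (s : alphabet L -> A) : Prop :=
  [/\ (forall X, lsets L X -> projection (p X)) /\
      (forall a, partial_isometry (s a)),
      [/\ forall X Y, lsets L X -> lsets L Y -> p (X `&` Y) = p X ** p Y,
          forall X Y, lsets L X -> lsets L Y ->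
            p (X `|` Y) = p X + p Y - p (X `&` Y)
        & p set0 = 0],
      forall X a, lsets L X -> p X ** s a = s a ** p (rrange X [:: a]),
      (forall a, star (s a) ** s a = p (wrange [:: a])) /\
      (forall a b, b != a -> star (s b) ** s a = 0)
    & forall X, lsets L X -> out_labels X !=set0 -> finite_set (out_labels X) ->
        ~ (exists Y, [/\ lsets L Y, Y !=set0 & Y `<=` X `&` sinks L]) ->
        p X = \sum_(a \in out_labels X)
                s a ** p (rrange X [:: a]) ** star (s a)].

(* The universal property determines (A, p, s) up to isomorphism on the members
   of the family. *)
Definition universal_representation (A : cstarAlgType R)
    (p : set (vertex L) -> A) (s : alphabet L -> A) : Prop :=
  [/\ representation p s,
      cstar_generated ([set p X | X in lsets L] `|` range s) = setT
    & forall (B : cstarAlgType R) (q : set (vertex L) -> B)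
             (t : alphabet L -> B),
        representation q t ->
        exists h : A -> B, [/\ star_hom h,
          forall X, lsets L X -> h (p X) = q X & forall a, h (s a) = t a]].

(* s_alpha p_X s_alpha^*, where s_alpha for the empty word is a formal unit. *)
Definition sandwich (A : cstarAlgType R)
    (p : set (vertex L) -> A) (s : alphabet L -> A)
    (alpha : seq (alphabet L)) (X : set (vertex L)) : A :=
  if alpha is a :: w then
    let s_alpha := foldl (fun x b => x ** s b) (s a) w in
    s_alpha ** p X ** star s_alpha
  else p X.

Definition diagonal_algebra (A : cstarAlgType R)
    (p : set (vertex L) -> A) (s : alphabet L -> A) : set A :=
  cstar_generated [set x | exists alpha X,
    [/\ labels L alpha, lsets_below alpha X & x = sandwich p s alpha X]].

End LabelledSpaceAlgebra.

Definition homeomorphic (X Y : topologicalType) : Prop :=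
  exists (f : X -> Y) (g : Y -> X),
    [/\ cancel f g, cancel g f, continuous f & continuous g].

(* Main.v *)
(* A tight filter xi gives the character d |-> <h(d) delta_xi, delta_xi> of the
   diagonal, where h : C*(E, L, B) -> B(l^2(T)) comes from the universal property
   applied to the representation in which p_X is the projection onto the tight
   filters containing (omega, X, omega) and s_a moves delta_xi to delta_(a xi).
   Conversely a character chi gives the filter of the idempotents (alpha, X, alpha)
   with chi(s_alpha p_X s_alpha^* ) = 1. It is tight because the Cuntz-Krieger
   relation (iv) lets one descend along a word of the filter until the finite cover
   is exhausted. Both constructions are inverse to each other on the generators, so
   what remains is continuity: *-homomorphisms into B(H) and characters are
   contractive, because a self-adjoint x with |x| < 1 satisfies x^2 = 2y - y^2 for
   a self-adjoint y of the same (non-unital) C*-algebra. *)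
Require Import Defs.
From HB Require Import structures.
From mathcomp Require Import all_boot all_order all_algebra complex finmap.
From mathcomp Require Import all_classical all_reals.
From mathcomp Require Import topology normedtype.
From mathcomp Require Import sequences ring lra.
From mathcomp.analysis.showcase Require Import summability.

Set Implicit Arguments.
Unset Strict Implicit.
Unset Printing Implicit Defensive.

Import Order.TTheory GRing.Theory Num.Theory.
Import numFieldNormedType.Exports.
Import complex.ComplexField.Normc.

Local Open Scope classical_set_scope.
Local Open Scope complex_scope.
Local Open Scope ring_scope.

(** * Tight filters *)

(** Two difficulties shape the proof. Products of idempotents are defined by cases on prefixes;
    replacing (w, A, w) by the set [cyl] of all (w u, v) with v in r(A, u) turns products into
    intersections and the order into inclusion, so identities in E(S) become identities of sets.
    Moreover, finite covers do not mention the relations of the algebra. The link is a pair of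
    properties: a filter containing a union contains one of its parts, and a filter containing a
    regular set A contains some (a, r(A, a), a). Tight filters have both, which gives additivity of
    p and relation (iv) on l^2(T). Conversely a character takes only the values 0 and 1 on the
    generating projections, so its filter inherits both properties from the same relations, at every
    word, and they imply tightness. The functional attached to xi is multiplicative on the diagonal
    because delta_xi is a common eigenvector there: each generator multiplies it by 0 or 1, and
    having this eigenvector survives sums, products and norm limits. *)

Lemma In_map_mem (T : Type) (T' : eqType) (f : T -> T') (s : seq T) z :
  List.In z s -> f z \in map f s.
Proof.
elim: s => //= y s IH [->|/IH fz]; rewrite in_cons ?eqxx //.
by rewrite fz orbT.
Qed.

(** * Relative ranges of words *)

Section Ranges.
Variable G : labelledGraph.
Implicit Types (A B : set (vertex G)) (a : alphabet G) (u w : seq (alphabet G)).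

Lemma rrange_cons A a w : rrange A (a :: w) = rrange (rrange A [:: a]) w.
Proof.
case: w => [//|b w]; apply/seteqP; split => v.
- move=> /= [e [[|f l] [//= /andP[/= /eqP ef pl] [ea fb lw] Ae ->]]].
  exists f, l; split => //=; first by rewrite fb lw.
  by exists e, [::]; split => //=; rewrite ea.
- move=> /= [f [l [pl [fb lw] [e [[|? ?] [_ //= [ea] Ae fe]]] ->]]].
  exists e, (f :: l); split => //=; last by rewrite ea fb lw.
  by rewrite /is_path /= -fe eqxx.
Qed.

Lemma rrange_cat A u w : rrange A (u ++ w) = rrange (rrange A u) w.
Proof.
elim: u A => [//|a u IH] A.
by rewrite cat_cons rrange_cons IH -rrange_cons.
Qed.

(** A path has a single source, so ranges are computed one vertex at a time. Monotonicity and unions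
    follow at once; intersections do not, since two paths with the same label may share their range
    but not their source, and that is where weak left-resolvingness enters ([rrangeI]). *)
Lemma rrange_pointwise A w v : rrange A w v <-> exists2 x, A x & rrange [set x] w v.
Proof.
case: w => [|a w] /=; first by split=> [?|[x ?] ->//]; exists v.
split=> [[e [l [pl lw Ae ->]]]|[x Ax [e [l [pl lw /= ex ->]]]]].
  by exists (src e) => //; exists e, l; split.
by exists e, l; split => //; rewrite ex.
Qed.

Lemma rrangeS A B w : A `<=` B -> rrange A w `<=` rrange B w.
Proof.
by move=> AB v /rrange_pointwise[x /AB Bx xv]; apply/rrange_pointwise; exists x.
Qed.

Lemma rrange0 w : rrange set0 w = set0 :> set (vertex G).
Proof. by apply/seteqP; split=> // v /rrange_pointwise[]. Qed.

Lemma rrangeU A B w : rrange (A `|` B) w = rrange A w `|` rrange B w.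
Proof.
apply/seteqP; split=> v.
  by case/rrange_pointwise => x [Ax|Bx] xv; [left|right];
    apply/rrange_pointwise; exists x.
by case=> /rrange_pointwise[x Ax xv]; apply/rrange_pointwise; exists x => //;
  [left|right].
Qed.

Lemma wrange_cat u w : wrange (u ++ w) = rrange (wrange u) w.
Proof. exact: rrange_cat. Qed.

Lemma wrange_cons a w : wrange (a :: w) `<=` wrange w.
Proof. by rewrite /wrange rrange_cons; exact: rrangeS. Qed.

Lemma rrange_wrange A w : rrange A w `<=` wrange w.
Proof. exact: rrangeS. Qed.

Lemma rrange_below A u w : A `<=` wrange u -> rrange A w `<=` wrange (u ++ w).
Proof. by move=> ?; rewrite /wrange rrange_cat; exact: rrangeS. Qed.

(** Replaces the existence of a path by a non-empty range. For the empty word this is the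
    non-emptiness of the vertex set. *)
Lemma labelsP w : labels G w <-> wrange w !=set0.
Proof.
split=> [[->|[e [l [pl lw]]]]|[v]].
- by case: (vertex_inhabited G) => v; exists v.
- by exists (rng (last e l)); rewrite -lw; exists e, l; split.
- case: w => [|a w]; first by left.
  by case=> e [l [pl lw _ _]]; right; exists e, l.
Qed.

Lemma wrange1_neq0 a : wrange [:: a] !=set0.
Proof.
have [e ea] := lab_surjective a.
by exists (rng e); exists e, [::]; split => //=; rewrite ea.
Qed.

Lemma rrange1_out_labels A a : rrange A [:: a] !=set0 <-> out_labels A a.
Proof.
split=> [[v /= [e [[|? ?] [_ //= [ea] Ae _]]]]|[e Ae <-]]; first by exists e.
by exists (rng e), e, [::].
Qed.

End Ranges.

Arguments rrange : simpl never.
Arguments wrange : simpl never.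

(** * Idempotents as cylinder sets *)

Section SetFamily.
Variable L : labelledSpace.
Hypotheses (wlr : weakly_left_resolving L) (relc : closed_rel_complements L).
Implicit Types (A B C : set (vertex L)) (a b : alphabet L).
Implicit Types (u w : seq (alphabet L)) (x y z : preidem L).

(** Some edge exists, so the family contains the range of its label, and then the complement of that
    set in itself. *)
Lemma lsets0 : lsets L set0.
Proof.
have [e] := edge_inhabited L; have [_ _ /(_ [:: lab e]) + _] := lsets_accommodating L.
move=> /(_ (ex_intro _ e (ex_intro _ [::] (conj isT erefl)))) Br.
by rewrite -(setDv (wrange [:: lab e])); exact: relc.
Qed.

Lemma lsetsI A B : lsets L A -> lsets L B -> lsets L (A `&` B).
Proof. by case: (lsets_accommodating L) => + _ _ _; apply. Qed.

Lemma lsetsU A B : lsets L A -> lsets L B -> lsets L (A `|` B).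
Proof. by case: (lsets_accommodating L) => _ + _ _; apply. Qed.

(** A word that is not a label has empty range, so the closure property holds for all words and no
    label condition has to be carried along. *)
Lemma lsets_rrange A w : lsets L A -> lsets L (rrange A w).
Proof.
move=> LA; have [lw|nlw] := pselect (labels L w).
  by case: (lsets_accommodating L) => _ _ _; apply.
suff -> : rrange A w = set0 by exact: lsets0.
by apply/seteqP; split=> // v /rrange_wrange wv; case: nlw; apply/labelsP; exists v.
Qed.

Lemma lsets_wrange a w : lsets L (wrange (a :: w)).
Proof.
have [[//|lw]|nlw] := pselect (labels L (a :: w)).
  by case: (lsets_accommodating L) => _ _ + _; apply.
suff -> : wrange (a :: w) = set0 :> set (vertex L) by exact: lsets0.
by apply/seteqP; split=> // v wv; case: nlw; apply/labelsP; exists v.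
Qed.

Lemma rrangeI A B w : lsets L A -> lsets L B ->
  rrange (A `&` B) w = rrange A w `&` rrange B w.
Proof.
move=> LA LB; case: w => [//|a w].
have [[//|lw]|nlw] := pselect (labels L (a :: w)); first exact: wlr.
have nwr v : ~ wrange (a :: w) v by move=> wv; apply/nlw/labelsP; exists v.
by apply/seteqP; split=> [v /rrange_wrange /nwr|v [/rrange_wrange /nwr]].
Qed.

Lemma idemP w A : idem (Some (w, A)) <-> lsets_below w A /\ A !=set0.
Proof.
split=> [[]//|[[LA Aw] A0]]; split => //.
by apply/labelsP; case: A0 => v /Aw; exists v.
Qed.

Lemma mk_idem_some w A : A !=set0 -> mk_idem w A = Some (w, A) :> preidem L.
Proof. by move=> A0; rewrite /mk_idem; case: asboolP. Qed.

Lemma idem_mk w A : lsets L A -> A `<=` wrange w -> idem (mk_idem w A).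
Proof.
by move=> LA Aw; rewrite /mk_idem; case: asboolP => // A0; apply/idemP.
Qed.

(* The idempotent (w, A, w) as the set of all (w u, v) with v in r(A, u):
   by weak left-resolvingness this turns products into intersections. *)
Definition cyl x : set (seq (alphabet L) * vertex L) :=
  if x is Some (w, A) then
    [set uv | prefix w uv.1 /\ rrange A (drop (size w) uv.1) uv.2]
  else set0.

Arguments cyl : simpl never.

Lemma cyl_none : cyl None = set0. Proof. by []. Qed.

Lemma cyl_catP w A u v : cyl (Some (w, A)) (w ++ u, v) <-> rrange A u v.
Proof. by rewrite /cyl /= prefix_prefix drop_size_cat //; split=> [[]|]. Qed.

Lemma cylP w A q : cyl (Some (w, A)) q <-> exists2 u, q.1 = w ++ u & rrange A u q.2.
Proof.
case: q => q v; split=> [[/= /prefixP[u ->]]|[u /= -> Au]].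
  by rewrite drop_size_cat //; exists u.
exact/cyl_catP.
Qed.

Lemma cyl_mk w A : cyl (mk_idem w A) = cyl (Some (w, A)).
Proof.
rewrite /mk_idem; case: asboolP => // /set0P/negP/negPn/eqP ->.
by apply/seteqP; split=> // q /cylP[u _]; rewrite rrange0.
Qed.

Lemma prefix_total (T : eqType) (s t r : seq T) :
  prefix s r -> prefix t r -> prefix s t || prefix t s.
Proof.
elim: s t r => [|c s IH] [|d t] [|e r] //= /andP[/eqP -> sr] /andP[/eqP -> tr].
by rewrite eqxx; exact: IH sr tr.
Qed.

(** For comparable words, [rrangeI] distributes the range of the remaining word over the
    intersection. Incomparable words have no common extension ([prefix_total]), matching the zero
    product. *)
Lemma cylM x y : idem x -> idem y -> cyl (idem_mul x y) = cyl x `&` cyl y.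
Proof.
case: x y => [[u A]|] [[w B]|] /=; rewrite ?cyl_none ?setI0 ?set0I //.
move=> [_ [LA _] _] [_ [LB _] _].
case: ifPn => [/prefixP[t ->]|uw].
  rewrite drop_size_cat // cyl_mk; apply/seteqP; split=> -[q v].
    case/cylP => s /= ->; rewrite rrangeI //; last exact: lsets_rrange.
    rewrite -rrange_cat => -[At Bs]; split; last by apply/cyl_catP.
    by rewrite -catA; apply/cyl_catP.
  case=> uq /cylP[s /= qs Bs]; move: uq; rewrite qs -catA => /cyl_catP As.
  rewrite catA; apply/cyl_catP; rewrite rrangeI //; last exact: lsets_rrange.
  by rewrite -rrange_cat.
case: ifPn => [/prefixP[t ->]|wu].
  rewrite drop_size_cat // cyl_mk; apply/seteqP; split=> -[q v].
    case/cylP => s /= ->; rewrite rrangeI //; last exact: lsets_rrange.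
    rewrite -rrange_cat => -[At Bs]; split; first by apply/cyl_catP.
    by rewrite -catA; apply/cyl_catP.
  case=> /cylP[s /= -> As]; rewrite -catA => /cyl_catP Bs.
  rewrite catA; apply/cyl_catP; rewrite rrangeI //; last exact: lsets_rrange.
  by rewrite -rrange_cat.
apply/seteqP; split=> // q [[/= uq _] [/= wq _]].
by have := prefix_total uq wq; rewrite (negbTE uw) (negbTE wu).
Qed.

Lemma idemM x y : idem x -> idem y -> idem (idem_mul x y).
Proof.
case: x y => [[u A]|] [[w B]|] //= [_ [LA Au] _] [_ [LB Bw] _].
case: ifPn => [/prefixP[t ->]|uw].
  apply: idem_mk; rewrite drop_size_cat //; first exact/lsetsI/LB/lsets_rrange.
  by move=> v [Av _]; exact: (rrange_below Au Av).
case: ifPn => [/prefixP[t ->]|//].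
apply: idem_mk; rewrite drop_size_cat //; first exact/lsetsI/lsets_rrange.
by move=> v [_ Bv]; exact: (rrange_below Bw Bv).
Qed.

Lemma cyl_neq0 x : idem x -> x <> None <-> cyl x !=set0.
Proof.
case: x => [[w A]|] /=; last by split=> // -[].
case=> _ _ [v Av]; split=> // _; exists (w, v).
by rewrite -[w in (w, v)]cats0; apply/cyl_catP.
Qed.

(** Since A is non-empty, the set contains a point over w itself, so w is the shortest word that
    occurs, and A is the fibre over it. With [cylM] this reduces equations in the semilattice to
    equations of sets. *)
Lemma cyl_inj x y : idem x -> idem y -> cyl x = cyl y -> x = y.
Proof.
move=> Ex Ey xy; case: x y Ex Ey xy => [[u A]|] [[w B]|] Ex Ey xy //=; last first.
- have /cyl_neq0 : Some (w, B) <> None by [].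
  by move=> /(_ Ey); rewrite -xy => -[].
- have /cyl_neq0 : Some (u, A) <> None by [].
  by move=> /(_ Ex); rewrite xy => -[].
have pre u1 w1 A1 B1 : idem (Some (u1, A1)) -> cyl (Some (u1, A1)) = cyl (Some (w1, B1)) ->
    prefix w1 u1.
  move=> [_ _ [v Av]] e; have : cyl (Some (u1, A1)) (u1 ++ [::], v) by apply/cyl_catP.
  by rewrite e cats0 => -[].
have uw : u = w.
  have /prefixP[s us] := pre _ _ _ _ Ex xy.
  have /prefixP[t] := pre _ _ _ _ Ey (esym xy).
  move/(congr1 size); rewrite us !size_cat -addnA => /eqP.
  rewrite -[X in X == _]addn0 eqn_add2l eq_sym addn_eq0 => /andP[/eqP/size0nil -> _].
  by rewrite cats0.
subst w; congr (Some (_, _)); apply/seteqP; split=> v ABv.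
  have : cyl (Some (u, A)) (u ++ [::], v) by apply/cyl_catP.
  by rewrite xy => /cyl_catP.
have : cyl (Some (u, B)) (u ++ [::], v) by apply/cyl_catP.
by rewrite -xy => /cyl_catP.
Qed.

Lemma idem_mulC x y : idem x -> idem y -> idem_mul x y = idem_mul y x.
Proof.
move=> Ex Ey; apply: cyl_inj; [exact: idemM|exact: idemM|].
by rewrite !cylM // setIC.
Qed.

Lemma meet_leP x y : idem x -> idem y -> meet_le (@idem_mul L) x y <-> cyl x `<=` cyl y.
Proof.
move=> Ex Ey; split=> [xy|/setIidPl xy].
  by apply/setIidPl; rewrite -cylM // xy.
by apply: cyl_inj => //; [exact: idemM|rewrite cylM].
Qed.

Lemma idem_mul_neq0 x y : idem x -> idem y ->
  idem_mul x y <> None <-> cyl x `&` cyl y !=set0.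
Proof. by move=> Ex Ey; rewrite -cylM //; exact/cyl_neq0/idemM. Qed.

Lemma filterM (xi : set (preidem L)) x y :
  is_filter (@idem L) None (@idem_mul L) xi -> idem x -> idem y ->
  xi (idem_mul x y) <-> xi x /\ xi y.
Proof.
move=> [_ _ _ up xiM] Ex Ey; split=> [xixy|[]]; last exact: xiM.
have Exy := idemM Ex Ey; split; apply: (up _ _ xixy) => //;
  by apply/meet_leP => //; rewrite cylM // => q [].
Qed.

(** Common pattern of adding and removing a letter. The map [psi] plays the part of an adjoint of
    [phi]: x meets [psi y] exactly when [phi x] meets y. Hence [phi] carries covers of x to covers
    of [phi x], and tightness can be pulled back. *)
Lemma tight_preimage (phi psi : preidem L -> preidem L) (xi : set (preidem L)) :
  tight_filters xi ->
  (forall x, idem x -> idem (phi x)) -> (forall x, idem x -> idem (psi x)) ->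
  phi None = None ->
  (forall x y, idem x -> idem y -> phi (idem_mul x y) = idem_mul (phi x) (phi y)) ->
  (forall x y, idem x -> idem y ->
    idem_mul x (psi y) <> None <-> idem_mul (phi x) y <> None) ->
  (forall x y, idem x -> idem y ->
    meet_le (@idem_mul L) y (phi x) -> meet_le (@idem_mul L) (psi y) x) ->
  (exists2 x, idem x & xi (phi x)) ->
  tight_filters [set x | idem x /\ xi (phi x)].
Proof.
move=> [fxi txi] Ephi Epsi phi0 phiM adj psile [x0 Ex0 xix0].
have [xiE _ xi0 up xiM] := fxi; split.
  split=> [x []//||[_]|x y [Ex xx] Ey xy|x y [Ex xx] [Ey xy]].
  - by exists x0.
  - by rewrite phi0.
  - by split=> //; apply: (up _ _ xx); [exact: Ephi|rewrite /meet_le -phiM // xy].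
  - by split; [exact: idemM|rewrite phiM //; exact: xiM].
move=> x Z Ex finZ [Zx covZ].
have EZ z : Z z -> idem z by move=> /Zx[].
have : is_cover (@idem L) None (@idem_mul L) (phi x) (phi @` Z).
  split=> [_ [z Zz <-]|y Ey yx y0].
    split; first exact/Ephi/EZ.
    by have [Ez zx] := Zx _ Zz; rewrite /meet_le -phiM // zx.
  (* A non-zero y below [phi x] has [psi y] below x and, by the adjunction, non-zero. Some z of the
     cover meets it, and the adjunction turns this into [phi z] meeting y. *)
  have : idem_mul x (psi y) <> None.
    by apply/adj => //; rewrite idem_mulC ?yx //; exact: Ephi.
  move=> xy0; have [|||z Zz] := covZ (psi y).
  - exact: Epsi.
  - exact: psile.
  - by move=> py; apply: xy0; rewrite py; case: x {Ex Zx covZ yx} => [[]|].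
  by move=> /adj zy; exists (phi z); [exists z|apply: zy => //; exact: EZ].
move/(txi _ _ (Ephi _ Ex) (finite_image _ finZ)) => H; split.
  by move=> [_ /H[_ [[z Zz <-] xiz]]]; exists z; split=> //; split=> //; exact: EZ.
by case=> z [Zz [Ez xiz]]; split=> //; apply/H; exists (phi z); split=> //; exists z.
Qed.

(** * Adding and removing a first letter *)

Definition pull a x : preidem L :=
  match x with
  | Some ([::], B) => mk_idem [::] (rrange B [:: a])
  | Some (b :: w, B) => if b == a then Some (w, B) else None
  | None => None
  end.

(** In the algebra, [pull a] is conjugation e |-> s_a^* e s_a and [push a] is e |-> s_a e s_a^*.
    Intersecting with r(a w) makes the result an idempotent over the word a w; the part of A outside
    r(a w) is killed by s_a. *)
Definition push a x : preidem L :=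
  if x is Some (w, A) then mk_idem (a :: w) (A `&` wrange (a :: w)) else None.

Lemma cyl_pull a x u v : cyl (pull a x) (u, v) <-> cyl x (a :: u, v).
Proof.
case: x => [[[|b w] B]|//].
  rewrite cyl_mk -[u]cat0s cyl_catP -[a :: _]cat0s cyl_catP.
  by rewrite [rrange B (a :: _)]rrange_cons.
by rewrite /pull eq_sym; case: eqP => [->|ab];
  rewrite /cyl /= ?eqxx //; split=> // -[/=]; case: eqP => // ?; case: ab.
Qed.

Lemma idem_pull a x : idem x -> idem (pull a x).
Proof.
case: x => [[[|b w] B]|//] [_ [LB Bw] B0].
  by apply: idem_mk; [exact: lsets_rrange|].
rewrite /pull; case: eqP => // _; apply/idemP; split=> //; split=> //.
exact: subset_trans Bw (@wrange_cons _ _ _).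
Qed.

Lemma cyl_push a x q : idem x -> cyl (push a x) q <->
  exists u, [/\ q.1 = a :: u, cyl x (u, q.2) & wrange (a :: u) q.2].
Proof.
case: x => [[w A]|] /=; last by move=> _; split=> // -[u []].
case=> _ [LA Aw] _; case: q => q v; rewrite cyl_mk; split.
  case/cylP => s /= ->; rewrite rrangeI //; last exact: lsets_wrange.
  rewrite -wrange_cat /= => -[As ws]; exists (w ++ s); split=> //.
  exact/cyl_catP.
case=> u [/= -> /(@cylP w A (u, v))[s /= ->] As]; rewrite -cat_cons => ws.
apply/cyl_catP; rewrite rrangeI //; last exact: lsets_wrange.
by split=> //; rewrite -wrange_cat.
Qed.

Lemma idem_push a x : idem x -> idem (push a x).
Proof.
case: x => [[w A]|//] [_ [LA Aw] A0].
by apply: idem_mk; [exact/lsetsI/lsets_wrange|exact: subIsetr].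
Qed.

Lemma pullM a x y : idem x -> idem y ->
  pull a (idem_mul x y) = idem_mul (pull a x) (pull a y).
Proof.
move=> Ex Ey; apply: cyl_inj.
- exact/idem_pull/idemM.
- by apply: idemM; exact: idem_pull.
rewrite cylM; [|exact: idem_pull..]; apply/seteqP; split=> -[u v].
  by rewrite cyl_pull cylM // => -[? ?]; split; apply/cyl_pull.
by case=> /cyl_pull ? /cyl_pull ?; apply/cyl_pull; rewrite cylM.
Qed.

Lemma pushM a x y : idem x -> idem y ->
  push a (idem_mul x y) = idem_mul (push a x) (push a y).
Proof.
move=> Ex Ey; have Exy := idemM Ex Ey; apply: cyl_inj.
- exact/idem_push.
- by apply: idemM; exact: idem_push.
rewrite cylM; [|exact: idem_push..]; apply/seteqP; split=> q.
  case/cyl_push => // u [qu]; rewrite cylM // => -[xu yu] ru.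
  by split; apply/cyl_push => //; exists u.
case=> /cyl_push[]// u [qu xu ru] /cyl_push[]// u' [].
rewrite qu => -[<-] yu _; apply/cyl_push => //; exists u; split=> //.
by rewrite cylM.
Qed.

(** Both sides ask for a point (a u, v) of [cyl x] with (u, v) in [cyl y]. The further condition in
    [cyl_push], that v lies in r(a u), holds for every point of [cyl x]. *)
Lemma push_pull_adjoint a x y : idem x -> idem y ->
  idem_mul x (push a y) <> None <-> idem_mul (pull a x) y <> None.
Proof.
move=> Ex Ey; rewrite !idem_mul_neq0 //; [|exact: idem_pull|exact: idem_push].
split=> [[[q v] [xq /cyl_push[]// u /= [qu yu ru]]]|[[u v] [/cyl_pull xu yu]]].
  by exists (u, v); split=> //; apply/cyl_pull; rewrite -qu.
exists (a :: u, v); split=> //; apply/cyl_push => //; exists u; split=> //=.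
case: x Ex xu => [[w A]|//] [_ [_ Aw] _] /cylP[s /= ->].
exact: rrange_below.
Qed.

Lemma push_le a x y : idem x -> idem y ->
  meet_le (@idem_mul L) y (pull a x) -> meet_le (@idem_mul L) (push a y) x.
Proof.
move=> Ex Ey; rewrite !meet_leP //; [|exact: idem_push|exact: idem_pull].
move=> yx [q v] /cyl_push[]// u /= [-> yu ru].
by apply/cyl_pull; exact: yx.
Qed.

Lemma pull_le a x y : idem x -> idem y ->
  meet_le (@idem_mul L) y (push a x) -> meet_le (@idem_mul L) (pull a y) x.
Proof.
move=> Ex Ey; rewrite !meet_leP //; [|exact: idem_pull|exact: idem_push].
by move=> yx [u v] /cyl_pull /yx /cyl_push[]// u' /= [[<-]].
Qed.

(** The idempotents of the initial projection s_a^* s_a and of the final projection s_a s_a^*. The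
    first decides whether a may be put in front of a filter, the second whether a filter begins with
    a. *)
Definition dom_idem a : preidem L := Some ([::], wrange [:: a]).
Definition ran_idem a : preidem L := Some ([:: a], wrange [:: a]).

Lemma idem_dom a : idem (dom_idem a).
Proof.
by apply/idemP; split; [split=> //; exact: lsets_wrange|exact: wrange1_neq0].
Qed.

Lemma idem_ran a : idem (ran_idem a).
Proof.
by apply/idemP; split; [split=> //; exact: lsets_wrange|exact: wrange1_neq0].
Qed.

Lemma pull_push a x : idem x -> pull a (push a x) = idem_mul x (dom_idem a).
Proof.
move=> Ex; have Ed := idem_dom a; apply: cyl_inj.
- exact/idem_pull/idem_push.
- exact: idemM.
have dP u v : cyl (dom_idem a) (u, v) <-> wrange (a :: u) v.
  by rewrite -[u in (u, v)]cat0s cyl_catP -wrange_cat.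
rewrite cylM //; apply/seteqP; split=> -[u v].
  by case/cyl_pull/cyl_push => // u' /= [[<-] xu /dP].
by case=> xu /dP du; apply/cyl_pull/cyl_push => //; exists u.
Qed.

Lemma push_pull a x : idem x -> push a (pull a x) = idem_mul x (ran_idem a).
Proof.
move=> Ex; have Ed := idem_ran a; have Ep := idem_pull a Ex; apply: cyl_inj.
- exact/idem_push.
- exact: idemM.
have dP u v : cyl (ran_idem a) (a :: u, v) <-> wrange (a :: u) v.
  by rewrite -(cat1s a u) cyl_catP -wrange_cat.
rewrite cylM //; apply/seteqP; split=> -[q v].
  by case/cyl_push => // u' /= [-> /cyl_pull xu /dP].
case=> xq /cylP[u /= qu ru]; move: xq; rewrite qu => xu.
apply/cyl_push => //; exists u; split=> //=; first exact/cyl_pull.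
by rewrite -(cat1s a u) wrange_cat.
Qed.

(** With filters seen as generalised paths, these put a in front of a path and strip it off; being
    preimages, they use the map going the other way. *)
Definition cons_filter a (xi : set (preidem L)) := [set x | idem x /\ xi (pull a x)].
Definition behead_filter a (xi : set (preidem L)) := [set x | idem x /\ xi (push a x)].

Section Shift.
Variables (a : alphabet L) (xi : set (preidem L)).
Hypothesis txi : tight_filters xi.
Let fxi : is_filter (@idem L) None (@idem_mul L) xi := proj1 txi.

Lemma tight_cons : xi (dom_idem a) -> tight_filters (cons_filter a xi).
Proof.
move=> xia; apply: (tight_preimage (psi := push a)) => //.
- exact: idem_pull.
- exact: idem_push.
- exact: pullM.
- exact: push_pull_adjoint.
- exact: push_le.
- by exists (ran_idem a); [exact: idem_ran|rewrite /pull /ran_idem eqxx].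
Qed.

Lemma tight_behead : xi (ran_idem a) -> tight_filters (behead_filter a xi).
Proof.
move=> xia; apply: (tight_preimage (psi := pull a)) => //.
- exact: idem_push.
- exact: idem_pull.
- exact: pushM.
- move=> x y Ex Ey; rewrite idem_mulC //; last exact: idem_pull.
  rewrite [X in _ <-> X <> _]idem_mulC //; last exact: idem_push.
  by rewrite push_pull_adjoint.
- exact: pull_le.
- exists (dom_idem a); first exact: idem_dom.
  rewrite /push /dom_idem setIid mk_idem_some //; exact: wrange1_neq0.
Qed.

Lemma cons_filterK : xi (dom_idem a) -> behead_filter a (cons_filter a xi) = xi.
Proof.
move=> xia; apply/seteqP; split=> x.
  by case=> Ex [_]; rewrite pull_push // => /(filterM fxi Ex (idem_dom a))[].
case: (fxi) => xiE _ _ _ _ xix; have Ex := xiE _ xix; split=> //.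
split; first exact: idem_push.
by rewrite pull_push //; apply/(filterM fxi Ex (idem_dom a)).
Qed.

Lemma behead_filterK : xi (ran_idem a) -> cons_filter a (behead_filter a xi) = xi.
Proof.
move=> xia; apply/seteqP; split=> x.
  by case=> Ex [_]; rewrite push_pull // => /(filterM fxi Ex (idem_ran a))[].
case: (fxi) => xiE _ _ _ _ xix; have Ex := xiE _ xix; split=> //.
split; first exact: idem_pull.
by rewrite push_pull //; apply/(filterM fxi Ex (idem_ran a)).
Qed.

Lemma cons_filter_ran b : cons_filter a xi (ran_idem b) <-> a = b /\ xi (dom_idem a).
Proof.
rewrite /cons_filter /pull /ran_idem /= eq_sym; case: eqP => [<-|ab].
  by split=> [[]//|[_ xia]]; split=> //; exact: idem_ran.
by split=> [[_]|[]//]; case: fxi.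
Qed.

Lemma behead_filter_dom : behead_filter a xi (dom_idem a) <-> xi (ran_idem a).
Proof.
rewrite /behead_filter /push /dom_idem /= setIid mk_idem_some; last exact: wrange1_neq0.
by split=> [[]//|xia]; split=> //; exact: idem_dom.
Qed.

Lemma behead_filterP w A : lsets_below (a :: w) A ->
  behead_filter a xi (Some (w, A)) <-> xi (Some (a :: w, A)).
Proof.
case: fxi => xiE _ _ _ _ [LA Aw]; rewrite /behead_filter /push /=.
rewrite (setIidl Aw); split=> [[[_ _ A0]]|xiA].
  by rewrite mk_idem_some.
have /= [_ _ A0] := xiE _ xiA; split; last by rewrite mk_idem_some.
by apply/idemP; split=> //; split=> //; exact: subset_trans Aw (@wrange_cons _ _ _).
Qed.

(** The two parts cover the union. An empty part becomes zero through [mk_idem], and no filter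
    contains zero. *)
Lemma tight_setU A B : lsets L A -> lsets L B ->
  xi (Some ([::], A `|` B)) <-> xi (Some ([::], A)) \/ xi (Some ([::], B)).
Proof.
move=> LA LB; have [xiE _ xi0 up _] := fxi.
have [A0 B0] : (A `|` B !=set0 -> A !=set0 \/ B !=set0) /\
    ((A !=set0 \/ B !=set0) -> A `|` B !=set0).
  split; first by case=> v [Av|Bv]; [left|right]; exists v.
  by case=> -[v ABv]; exists v; [left|right].
have EU : A `|` B !=set0 -> idem (Some ([::], A `|` B)).
  by move=> AB0; apply/idemP; split=> //; split=> //; exact: lsetsU.
split.
  move=> xiU; have /= [_ _ U0] := xiE _ xiU.
  have [_ /(_ _ _ (EU U0)) txi'] := txi.
  have /txi' : finite_set [set mk_idem [::] A; mk_idem [::] B].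
    by rewrite finite_setU; split; exact: finite_set1.
  case.
    split=> [_ [|] ->|].
    - split; first exact: idem_mk.
      apply/meet_leP; [exact: idem_mk|exact: EU|rewrite cyl_mk].
      by move=> q /cylP[u qu Au]; apply/cylP; exists u => //; rewrite rrangeU; left.
    - split; first exact: idem_mk.
      apply/meet_leP; [exact: idem_mk|exact: EU|rewrite cyl_mk].
      by move=> q /cylP[u qu Au]; apply/cylP; exists u => //; rewrite rrangeU; right.
    move=> y Ey /meet_leP yU /(cyl_neq0 Ey)[q yq].
    have /cylP[u qu] := yU Ey (EU U0) _ yq; rewrite rrangeU => -[] qAB.
      exists (mk_idem [::] A); first by left.
      apply/idem_mul_neq0 => //; first exact: idem_mk.
      by exists q; split=> //; rewrite cyl_mk; apply/cylP; exists u.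
    exists (mk_idem [::] B); first by right.
    apply/idem_mul_neq0 => //; first exact: idem_mk.
    by exists q; split=> //; rewrite cyl_mk; apply/cylP; exists u.
  move=> /(_ xiU)[_ [[->|->]]]; rewrite /mk_idem;
    case: asboolP => // _ xiAB; by [left | right].
case=> xiA; have /= [_ _ AB0] := xiE _ xiA; apply: (up _ _ xiA).
- by apply: EU; apply: B0; left.
- apply/meet_leP; [exact: xiE|by apply: EU; apply: B0; left|].
  by move=> q /cylP[u qu Au]; apply/cylP; exists u => //; rewrite rrangeU; left.
- by apply: EU; apply: B0; right.
- apply/meet_leP; [exact: xiE|by apply: EU; apply: B0; right|].
  by move=> q /cylP[u qu Au]; apply/cylP; exists u => //; rewrite rrangeU; right.
Qed.

End Shift.

(** The condition under which relation (iv) is imposed. *)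
Definition regular A : Prop :=
  [/\ out_labels A !=set0, finite_set (out_labels A)
    & ~ (exists Y, [/\ lsets L Y, Y !=set0 & Y `<=` A `&` sinks L])].

(** The idempotents (a, r(A, a), a) form a finite cover of (omega, A, omega): finite because A emits
    finitely many labels, a cover because nothing non-zero below A consists of sinks. This is
    relation (iv) in terms of filters. *)
Lemma tight_regular (xi : set (preidem L)) A : tight_filters xi -> lsets L A ->
  regular A ->
  xi (Some ([::], A)) <->
  exists2 a, out_labels A a & xi (Some ([:: a], rrange A [:: a])).
Proof.
move=> [[xiE _ xi0 up _] txi] LA [A0 finA nsink].
have EA : idem (Some ([::], A)).
  by apply/idemP; split=> //; case: A0 => _ [e Ae _]; exists (src e).
have EAa a : out_labels A a -> idem (Some ([:: a], rrange A [:: a])).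
  move=> Aa; apply/idemP; split; last exact/rrange1_out_labels.
  by split; [exact: lsets_rrange|exact: rrange_wrange].
set Z := [set Some ([:: a], rrange A [:: a]) | a in out_labels A].
have : is_cover (@idem L) None (@idem_mul L) (Some ([::], A)) Z.
  split=> [_ [a Aa <-]|y Ey /(meet_leP Ey EA) yA y0].
    split; first exact: EAa.
    apply/meet_leP => //; first exact: EAa.
    move=> q /cylP[u qu]; rewrite -rrange_cat => Aau; apply/cylP.
    by exists ([:: a] ++ u).
  (* The point must lie over a non-empty word. If y has the empty word, its set contains a vertex
     that is not a sink, and an edge leaving that vertex supplies a one-letter word. *)
  have [q yq [Aq [a [u qau]]]] : exists2 q, cyl y q & cyl (Some ([::], A)) q /\
      exists a u, q.1 = a :: u.
    case: y Ey y0 yA => [[[|a w] B]|//] Ey y0 yA; last first.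
      have [q yq] := (cyl_neq0 Ey).1 y0; exists q => //; split; first exact: yA.
      by case/cylP: yq => u -> _; exists a, (w ++ u).
    have [_ [LB _] B0] := Ey.
    have /existsNP[v /not_implyP[Bv /existsNP[e /negP/negPn/eqP ev]]] :
        ~ (B `<=` sinks L).
      move=> Bs; apply: nsink; exists B; split=> // v Bv; split; last exact: Bs.
      by have : cyl (Some ([::], B)) ([::] ++ [::], v) by [apply/cyl_catP];
        move/yA => /cyl_catP.
    have Be : cyl (Some ([::], B)) ([::] ++ [:: lab e], rng e).
      by apply/cyl_catP; exists e, [::]; split=> //; rewrite ev.
    exists ([:: lab e], rng e) => //; split; first exact: yA.
    by exists (lab e), [::].
  move/cylP: (Aq) => [_ /= <-]; rewrite qau => Aau.
  have Aa : out_labels A a.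
    apply/rrange1_out_labels; move: Aau; rewrite rrange_cons.
    by case/rrange_pointwise => v Av _; exists v.
  exists (Some ([:: a], rrange A [:: a])); first by exists a.
  apply/idem_mul_neq0 => //; first exact: EAa.
  exists q; split=> //; apply/cylP; exists u => //.
  by rewrite -rrange_cons.
move/(txi _ _ EA (finite_image _ finA)) => ->; split.
  by case=> _ [[a Aa <-] xia]; exists a.
by case=> a Aa xia; exists (Some ([:: a], rrange A [:: a])); split=> //; exists a.
Qed.

(** * A criterion for tightness *)

Section PrimeRegular.
Variable xi : set (preidem L).
Hypothesis fxi : is_filter (@idem L) None (@idem_mul L) xi.
(** This and [regular_xi] are the two properties read off from a character: the first from
    additivity of p, the second from relation (iv), both conjugated by the word w. *)
Hypothesis prime_xi : forall w A B, lsets L B -> xi (Some (w, A)) ->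
  xi (mk_idem w (A `&` B)) \/ xi (mk_idem w (A `\` B)).
Hypothesis regular_xi : forall w A, xi (Some (w, A)) -> regular A ->
  exists2 a, out_labels A a & xi (Some (rcons w a, rrange A [:: a])).

Lemma filter_up x y : xi x -> idem y -> cyl x `<=` cyl y -> xi y.
Proof.
have [xiE _ _ up _] := fxi => xix Ey xy.
by apply: (up _ _ xix) => //; apply/meet_leP => //; exact: xiE.
Qed.

(** Each element (u, C, u) of s with u a prefix of w is removed by cutting A along r(C, rest of w).
    The intersection lies below that element, hence is not in the filter, so by primeness the
    difference is. *)
Lemma filter_remove (s : seq (preidem L)) w A :
  (forall z, List.In z s -> idem z /\ ~ xi z) -> xi (Some (w, A)) ->
  exists A', [/\ A' `<=` A, xi (Some (w, A')) &
    forall u C, List.In (Some (u, C)) s -> prefix u w ->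
      A' `&` rrange C (drop (size u) w) = set0].
Proof.
have [xiE _ xi0 _ _] := fxi => + xiA.
elim: s => [_|z s IH sxi]; first by exists A; split.
have [A' [A'A xiA' A's]] := IH (fun t ts => sxi t (or_intror ts)).
have [[[u C] zuC uw]|nz] := pselect (exists2 q, z = Some q & prefix q.1 w); last first.
  exists A'; split=> // u C [zuC uw|]; last exact: A's.
  by case: nz; exists (u, C).
have [Ez nxiz] := sxi z (or_introl erefl).
have LC : lsets L C by move: Ez; rewrite zuC => /idemP[[]].
pose B := rrange C (drop (size u) w).
have LB : lsets L B by exact: lsets_rrange.
have [xiI|xiD] := prime_xi LB xiA'.
  case: nxiz; apply: (filter_up xiI Ez); rewrite cyl_mk zuC => q /cylP[t qt].
  have [_ [LA' _] _] := xiE _ xiA'.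
  rewrite rrangeI // => -[_]; rewrite -rrange_cat => Ct; apply/cylP.
  exists (drop (size u) w ++ t) => //.
  by case/prefixP: uw qt => r ->; rewrite drop_size_cat // catA.
exists (A' `\` B); split=> [v [/A'A]//||u' C' [|Cs u'w]].
- by move: xiD; rewrite /mk_idem; case: asboolP.
- by rewrite zuC => -[<- <-] _; apply/seteqP; split=> // v [[_ nBv] /nBv].
- by apply/seteqP; split=> // v [[A'v _] Cv]; rewrite -(A's _ _ Cs u'w).
Qed.

(** After [filter_remove], an element whose word is a prefix of w cannot meet anything below (w, A',
    w); the cover must then be doing its work with words that go beyond w. *)
Lemma filter_cover_longer (s : seq (preidem L)) w A :
  (forall z, List.In z s -> idem z /\ ~ xi z) -> xi (Some (w, A)) ->
  (forall y, idem y -> y <> None -> cyl y `<=` cyl (Some (w, A)) ->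
    exists2 z, List.In z s & cyl z `&` cyl y !=set0) ->
  exists A', [/\ A' `<=` A, xi (Some (w, A')) &
    forall y, idem y -> y <> None -> cyl y `<=` cyl (Some (w, A')) ->
    exists u C q, [/\ List.In (Some (u, C)) s, ~~ prefix u w,
      cyl (Some (u, C)) q & cyl y q]].
Proof.
have [xiE _ _ _ _] := fxi => sxi xiA cov.
have [A' [A'A xiA' A's]] := filter_remove sxi xiA.
exists A'; split=> // y Ey y0 yA'.
have [|[[u C]|] zs [q [zq yq]]] // := cov y Ey y0.
  move=> q /yA' /cylP[t qt A't]; apply/cylP; exists t => //; exact: rrangeS A't.
exists u, C, q; split=> //; apply/negP => uw; have /cylP[t qt A't] := yA' _ yq.
have [[_ [LC _] _] _] := sxi _ zs; have [_ [LA' _] _] := xiE _ xiA'.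
have : rrange (A' `&` rrange C (drop (size u) w)) t q.2; last first.
  by rewrite A's // rrange0.
rewrite rrangeI //; last exact: lsets_rrange.
split=> //; rewrite -rrange_cat; move: zq => /cylP[r + Cr]; rewrite qt.
case/prefixP: uw => r' ->; rewrite drop_size_cat // -catA => /eqP.
by rewrite eqseq_cat // eqxx => /eqP ->.
Qed.

(** Induction on n, which bounds how far the words of the cover exceed w. If the cover misses the
    filter, the shrunken set A' is regular, so [regular_xi] lengthens w by a letter within the
    filter and n drops by one. *)
Lemma filter_cover (s : seq (preidem L)) n w A :
  (forall z, List.In z s -> idem z) ->
  (forall u C, List.In (Some (u, C)) s -> (size u <= size w + n)%N) ->
  xi (Some (w, A)) ->
  (forall y, idem y -> y <> None -> cyl y `<=` cyl (Some (w, A)) ->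
    exists2 z, List.In z s & cyl z `&` cyl y !=set0) ->
  exists2 z, List.In z s & xi z.
Proof.
have [xiE _ _ _ _] := fxi => Es.
elim: n w A => [|n IH] w A sn xiA cov; apply: contrapT => nsxi;
  (have [|A' [A'A xiA' cov']] := filter_cover_longer _ xiA cov;
    first by move=> z zs; split; [exact: Es|move=> xiz; apply: nsxi; exists z]).
  (* For n = 0: a word u sharing an extension with w, but not a prefix of it, extends w. Its length
     is at most that of w, so u equals w after all. *)
  have [//|u [C [q [us + uq wq]]]] := cov' _ (xiE _ xiA') _ (@subset_refl _ _).
  move=> /negP; apply; have := sn _ _ us; rewrite addn0 => sz.
  have [uq' wq'] := (uq.1, wq.1); have /orP[//|wu] := prefix_total uq' wq'.
  case/prefixP: wu sz => t ->; rewrite size_cat -[X in (_ <= X)%N]addn0.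
  by rewrite leq_add2l leqn0 => /nilP ->; rewrite cats0 prefix_refl.
have [_ [LA' A'w] [v0 A'v0]] := xiE _ xiA'.
have [a [Aa xia]] : exists a, out_labels A' a /\
    xi (Some (rcons w a, rrange A' [:: a])).
  suff /(regular_xi xiA')[a] : regular A' by exists a.
  (* A point met by the cover lies over w r. If r is non-empty, an edge leaves Y; if r is empty, the
     covering word is a prefix of w, which [cov'] excludes. *)
  have nsink Y : lsets L Y -> Y !=set0 -> Y `<=` A' -> ~ (Y `<=` sinks L).
    move=> LY Y0 YA' Ysink.
    have EY : idem (Some (w, Y)) by apply/idemP; do !split=> //; apply: subset_trans A'w.
    have [//||u [C [q [us uw /cylP[t qt _] /cylP[r qr Yr]]]]] := cov' _ EY.
      by move=> q /cylP[t qt Yt]; apply/cylP; exists t => //; exact: rrangeS Yt.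
    case: r qr Yr => [|b r]; rewrite qt.
      by rewrite cats0 => wE; move: uw; rewrite -wE prefix_prefix.
    move=> _ [e [l [_ _ /Ysink /(_ e)]]]; by rewrite eqxx.
  split.
  - have /existsNP[v /not_implyP[Av /existsNP[e /negP/negPn/eqP ev]]] :
        ~ (A' `<=` sinks L) by apply: nsink => //; exists v0.
    by exists (lab e), e => //=; rewrite ev.
  - have [e0] := edge_inhabited L.
    (* Finiteness of the labels leaving A': each occurs at position [size w] of some word of the
       finite cover. The default label is never the value that matters, since the words provided by
       [cov'] are longer than w. *)
    pose f z := if z is Some (u, _) then nth (lab e0) u (size w) else lab e0.
    apply: sub_finite_set (finite_seq (map f s)) => a Aa.
    have Ea : idem (Some (rcons w a, rrange A' [:: a])).
      apply/idemP; split; last exact/rrange1_out_labels.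
      by split; [exact: lsets_rrange|rewrite -cats1; exact: rrange_below].
    have [//||u [C [q [us uw /cylP[t qt _] /cylP[r qr _]]]]] := cov' _ Ea.
      move=> q /cylP[t]; rewrite -cats1 -catA => qt; rewrite -rrange_cat => At.
      by apply/cylP; exists ([:: a] ++ t).
    suff -> : a = f (Some (u, C)) by have := In_map_mem f us.
    have wu : (size w < size u)%N.
      rewrite ltnNge; apply: contra uw => uw; apply/prefixP.
      exists (drop (size u) w); rewrite -[LHS](cat_take_drop (size u)); congr (_ ++ _).
      transitivity (take (size u) q.1); first by rewrite qr cat_rcons takel_cat.
      by rewrite qt take_size_cat.
    have := congr1 (fun p => nth (lab e0) p (size w)) qr.
    by rewrite qt nth_cat wu nth_cat size_rcons ltnSn nth_rcons ltnn eqxx /f.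
  - by case=> Y [LY Y0 YA]; apply: (nsink Y) => // v /YA[].
apply: nsxi; apply: (IH (rcons w a) (rrange A' [:: a])) => //.
  by move=> u C /sn; rewrite size_rcons addSnnS.
move=> y Ey y0 yA; apply: cov => // q /yA /cylP[t].
rewrite -cats1 -catA => qt; rewrite -rrange_cat => At; apply/cylP.
by exists ([:: a] ++ t) => //; exact: rrangeS At.
Qed.

(** One half of tightness is upward closure. The other is [filter_cover], with n the largest word
    length in the finite cover. *)
Lemma tight_of_prime_regular : tight_filters xi.
Proof.
have [xiE _ xi0 up _] := fxi; split=> // x Z Ex finZ [Zx covZ]; split; last first.
  by case=> z [/Zx[Ez zx] xiz]; apply: (up _ _ xiz).
case: x Ex Zx covZ => [[w A] Ex Zx covZ xiA|//].
have /(@finite_seqP (Choice.clone _ {classic preidem L}))[s Zs] := finZ.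
have sZ z : List.In z s -> Z z.
  rewrite Zs /=; elim: s {Zs} => //= y s IH [->|/IH]; rewrite inE ?eqxx // => ->.
  by rewrite orbT.
have Zin z : Z z -> List.In z s.
  by rewrite Zs /=; elim: s {Zs sZ} => //= y s IH; rewrite inE => /orP[/eqP ->|/IH];
    [left|right].
have Es z : List.In z s -> idem z by move=> /sZ/Zx[].
pose n := \max_(z <- s) (if z is Some (u, _) then size u else 0%N).
have [||z zs xiz] := @filter_cover s n w A Es _ xiA.
- move=> u C us; apply: leq_trans (leq_addl _ _); rewrite /n {Zs sZ Zin Es n}.
  elim: s us => //= y s IH [->|/IH us]; rewrite big_cons ?leq_maxl //.
  exact: leq_trans us (leq_maxr _ _).
- move=> y Ey y0 /meet_leP yA; have [z Zz zy] := covZ y Ey (yA Ey Ex) y0.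
  exists z; first exact: Zin.
  by have /Zx[Ez _] := Zz; move/idem_mul_neq0: zy; apply.
- by exists z; split=> //; exact: sZ.
Qed.

End PrimeRegular.
End SetFamily.

(** * Square-summable functions *)

#[local] Existing Instance totally_filter.

Lemma ler_sum_fset (R : realType) (X : choiceType) (u : X -> R) (K K' : {fset X}) :
  (forall x, 0 <= u x) -> (K `<=` K')%fset ->
  \sum_(x <- K) u x <= \sum_(x <- K') u x.
Proof.
move=> u0 KK'.
have -> : \sum_(x <- K) u x = \sum_(x <- K) if x \in K then u x else 0.
  by apply: eq_big_seq => x ->.
rewrite (big_fset_incl _ KK'); last by move=> x _ /negbTE ->.
by apply: ler_sum => x _; case: ifP.
Qed.

Section SquareSummable.
Variables (R : realType) (X : choiceType).
Implicit Types (u f g : X -> R) (K : {fset X}).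

(** The finite sums increase along the directed set of finite subsets, so they converge to their
    supremum. *)
Lemma nneg_sum_cvg u (M : R) : (forall x, 0 <= u x) ->
  (forall K, \sum_(x <- K) u x <= M) ->
  cvg ((fun K => \sum_(x <- K) u x) @ totally).
Proof.
move=> u0 uM; pose S : set R := range (fun K => \sum_(x <- K) u x).
have supS : has_sup S.
  by split; [exists (\sum_(x <- fset0) u x), fset0|exists M => _ [K _ <-]].
apply/cvg_ex; exists (sup S); apply/cvgrPdist_lt => e e0.
have [_ [K0 _ <-] lt_sup] := sup_adherent e0 supS.
exists K0 => // K /= K0K; rewrite ger0_norm.
  by rewrite ltrBlDl -ltrBlDr (lt_le_trans lt_sup)//; exact: ler_sum_fset.
by rewrite subr_ge0; apply: sup_upper_bound => //; exists K.
Qed.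

(** Real-valued; the complex space is assembled in [cl2] from a real and an imaginary copy. *)
Definition square_summable : {pred X -> R^o} :=
  fun f => `[< exists M, forall K, \sum_(x <- K) f x ^+ 2 <= M >].

Lemma square_summable_submod_closed : submod_closed square_summable.
Proof.
(* Shows (a s + t)^2 <= 2 a^2 s^2 + 2 t^2, the source of the bound given below. *)
have sqE (a s t : R) : 2 * a ^+ 2 * s ^+ 2 + 2 * t ^+ 2 - (a * s + t) ^+ 2 =
    (a * s - t) ^+ 2 by ring.
split; first by apply/asboolP; exists 0 => K; rewrite big1 // => x _; rewrite expr0n.
move=> a f g /asboolP[M fM] /asboolP[N gN]; apply/asboolP.
exists (2 * a ^+ 2 * M + 2 * N) => K.
apply: (@le_trans _ _ (\sum_(x <- K) (2 * a ^+ 2 * f x ^+ 2 + 2 * g x ^+ 2))).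
  apply: ler_sum => x _; rewrite [(a *: f + g) x]/(a * f x + g x).
  by rewrite -subr_ge0 sqE sqr_ge0.
rewrite big_split /= -!mulr_sumr lerD //.
  by rewrite ler_wpM2l // mulr_ge0 // sqr_ge0.
by rewrite ler_wpM2l.
Qed.

HB.instance Definition _ := GRing.isSubmodClosed.Build R (X -> R^o)
  square_summable square_summable_submod_closed.

Record l2 := L2 { l2val :> X -> R^o; l2P : l2val \in square_summable }.
HB.instance Definition _ := [isSub for l2val].
HB.instance Definition _ := [Choice of l2 by <:].
HB.instance Definition _ := [SubChoice_isSubLmodule of l2 by <:].

Lemma l2_inj (f g : l2) : (forall x, f x = g x) -> f = g.
Proof. by move=> fg; apply: val_inj; apply/funext. Qed.

Lemma l2DE (f g : l2) x : (f + g) x = f x + g x. Proof. by []. Qed.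
Lemma l2NE (f : l2) x : (- f) x = - f x. Proof. by []. Qed.

Definition l2ip (f g : l2) : R :=
  lim ((fun K => \sum_(x <- K) f x * g x) @ totally).

(** Polarisation reduces convergence of sums of products to that of sums of squares. *)
Lemma l2ip_cvg (f g : l2) :
  (fun K => \sum_(x <- K) f x * g x) @ totally --> l2ip f g.
Proof.
suff : cvg ((fun K => \sum_(x <- K) f x * g x) @ totally) by [].
have sq_cvg (h : l2) : cvg ((fun K => \sum_(x <- K) h x ^+ 2) @ totally).
  have /asboolP[M hM] := l2P h.
  by apply: nneg_sum_cvg hM => x; exact: sqr_ge0.
pose s := fun h : l2 => fun K => \sum_(x <- K) h x ^+ 2.
have -> : (fun K => \sum_(x <- K) f x * g x) = fun K => 4^-1 * (s (f + g) K - s (f - g) K).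
  apply/funext => K; rewrite /s -sumrB mulr_sumr; apply: eq_bigr => x _.
  by rewrite !l2DE l2NE; field.
apply/cvg_ex; exists (4^-1 * (lim (s (f + g) @ totally) - lim (s (f - g) @ totally))).
by apply: cvgMl_tmp; apply: cvgB; exact: sq_cvg.
Qed.

Lemma l2ip_unique (f g : l2) l :
  (fun K => \sum_(x <- K) f x * g x) @ totally --> l -> l2ip f g = l.
Proof. by move=> h; apply: cvg_lim h; exact: Rhausdorff. Qed.

Lemma l2ipC (f g : l2) : l2ip f g = l2ip g f.
Proof.
apply: l2ip_unique; under eq_fun => K do under eq_bigr => x _ do rewrite mulrC.
exact: l2ip_cvg.
Qed.

Lemma l2ipDl (f g h : l2) : l2ip (f + g) h = l2ip f h + l2ip g h.
Proof.
apply: l2ip_unique.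
have -> : (fun K => \sum_(x <- K) (f + g) x * h x) =
    (fun K => \sum_(x <- K) f x * h x) + (fun K => \sum_(x <- K) g x * h x).
  by apply/funext => K; rewrite fctE -big_split; apply: eq_bigr => x _; rewrite mulrDl.
by apply: cvgD; exact: l2ip_cvg.
Qed.

Lemma l2ipZl a (f h : l2) : l2ip (a *: f) h = a * l2ip f h.
Proof.
apply: l2ip_unique.
have -> : (fun K => \sum_(x <- K) (a *: f) x * h x) =
    (fun K => a * \sum_(x <- K) f x * h x).
  by apply/funext => K; rewrite mulr_sumr; apply: eq_bigr => x _; rewrite mulrA.
by apply: cvgMl_tmp; exact: l2ip_cvg.
Qed.

Lemma l2ip_sum_le (f : l2) K : \sum_(x <- K) f x ^+ 2 <= l2ip f f.
Proof.
apply: limr_ge; first exact: l2ip_cvg.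
exists K => // K' /= KK'; under [leRHS]eq_bigr => x _ do rewrite -expr2.
by apply: ler_sum_fset => // x; exact: sqr_ge0.
Qed.

Lemma l2ip_le (f : l2) M : (forall K, \sum_(x <- K) f x ^+ 2 <= M) -> l2ip f f <= M.
Proof.
move=> fM; apply: limr_le; first exact: l2ip_cvg.
by apply: nearW => K; under eq_bigr => x _ do rewrite -expr2.
Qed.

Lemma l2ip_ge0 (f : l2) : 0 <= l2ip f f.
Proof. by have := l2ip_sum_le f fset0; rewrite big_seq_fset0. Qed.

Lemma l2_eval_le (f : l2) x : f x ^+ 2 <= l2ip f f.
Proof. by have := l2ip_sum_le f [fset x]%fset; rewrite big_seq_fset1. Qed.

Lemma l2ip_eq0 (f : l2) : l2ip f f = 0 -> f = 0.
Proof.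
move=> f0; apply: l2_inj => x; have := l2_eval_le f x; rewrite f0 => fx.
by apply/eqP; rewrite -sqrf_eq0 eq_le fx sqr_ge0.
Qed.

(** Evaluation at a point is contractive, so coordinatewise limits exist. The norm estimate is
    proved for finite partial sums, where limits may be taken termwise, and then for the whole
    sum. *)
Lemma l2_complete (F : set_system (l2)) : ProperFilter F ->
  (forall e, 0 < e -> exists2 A, F A &
    forall f g : l2, A f -> A g -> l2ip (f - g) (f - g) <= e) ->
  exists l : l2, forall e, 0 < e -> F [set f | l2ip (f - l) (f - l) <= e].
Proof.
move=> FF cauchyF.
have evF x : cvg ((fun f : l2 => f x : R) @ F).
  apply: R_complete; apply/cauchy_ballP => e e0; rewrite /= near_simpl.
  have e20 : 0 < (e / 2) ^+ 2 by rewrite exprn_gt0 // divr_gt0.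
  have [A FA Ae] := cauchyF _ e20.
  exists (A, A) => //= -[f g] /= [Af Ag]; apply/(@le_lt_trans _ _ (e / 2)); last lra.
  rewrite -(@ler_pXn2r _ 2) ?nnegrE //; last lra.
  rewrite real_normK ?num_real //; apply: le_trans (Ae _ _ Af Ag).
  exact: (l2_eval_le (f - g) x).
pose l0 x := lim ((fun f : l2 => f x : R) @ F).
(* With K and f fixed, g runs along the filter; the resulting bound does not depend on K. *)
have sum_le e A (f : l2) K : (forall f g : l2, A f -> A g -> l2ip (f - g) (f - g) <= e) ->
    F A -> A f -> \sum_(x <- K) (f x - l0 x) ^+ 2 <= e.
  move=> Ae FA Af.
  have cv : (fun g : l2 => \sum_(x <- K) (f x - g x) ^+ 2) @ F -->
      \sum_(x <- K) (f x - l0 x) ^+ 2.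
    apply: cvg_big => [|x _]; first exact: add_continuous.
    apply: cvgM; apply: cvgB; first [exact: cvg_cst | exact: evF].
  rewrite -(cvg_lim (@Rhausdorff R) cv); apply: limr_le.
    by apply/cvg_ex; exists (\sum_(x <- K) (f x - l0 x) ^+ 2).
  near=> g; apply: le_trans (Ae f g Af _).
    exact: (l2ip_sum_le (f - g)).
  by near: g.
have [A FA A1] := cauchyF _ (@ltr01 R).
have [f0 Af0] := filter_ex FA.
have l0P : l0 \in square_summable.
  have h : (fun x => f0 x - l0 x) \in square_summable.
    by apply/asboolP; exists 1 => K; exact: sum_le A1 FA Af0.
  have -> : l0 = (-1) *: ((fun x => f0 x - l0 x) : X -> R^o) + f0.
    by rewrite scaleN1r; apply/funext => x; rewrite 2!fctE opprB subrK.
  by apply: (square_summable_submod_closed).2 => //; exact: l2P.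
exists (L2 l0P) => e e0; have [B FB Be] := cauchyF _ e0.
apply: (filterS _ FB) => f Bf; apply: l2ip_le => K.
exact: sum_le Be FB Bf.
Unshelve. all: by end_near. Qed.

Definition transfer (t : X -> option X) (f : X -> R) : X -> R^o :=
  fun y => if t y is Some x then f x else 0.

Section Transfer.
Variables (s t : X -> option X).
Hypothesis stP : forall x y, s x = Some y <-> t y = Some x.

Lemma transfer_sumE f y K : (forall x, t y = Some x -> x \in K) ->
  transfer t f y = \sum_(x <- K) if s x == Some y then f x else 0.
Proof.
rewrite /transfer; case ty : (t y) => [x|] xK; last first.
  by rewrite big1 // => x _; case: eqP => // /stP; rewrite ty.
rewrite (big_fsetD1 x) /=; last exact: xK.
rewrite (iffRL (stP _ _) ty) eqxx big1_seq ?addr0 // => x' /andP[_].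
rewrite !inE => /andP[x'x _]; case: eqP => // /stP; rewrite ty => -[xx'].
by rewrite xx' eqxx in x'x.
Qed.

Lemma opt_imageP (r : X -> option X) K y :
  y \in [fset y in pmap r K]%fset <-> exists2 x, x \in K & r x = Some y.
Proof.
rewrite !inE /= mem_pmap; split=> [/mapP[x xK ->]|[x xK rx]]; first by exists x.
by apply/mapP; exists x.
Qed.

End Transfer.

(** Both sides equal the double sum over matched pairs (x, y) with [s x = Some y]. The two inclusion
    conditions say that partners of points of one index set lie in the other. *)
Lemma transfer_sum_adj (s t : X -> option X) f g K K' :
  (forall x y, s x = Some y <-> t y = Some x) ->
  (forall x y, t y = Some x -> y \in K' -> x \in K) ->
  (forall x y, s x = Some y -> x \in K -> y \in K') ->
  \sum_(y <- K') transfer t f y * g y = \sum_(x <- K) f x * transfer s g x.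
Proof.
move=> stP tK sK.
transitivity (\sum_(y <- K') \sum_(x <- K) if s x == Some y then f x * g y else 0).
  apply: eq_big_seq => y yK'.
  rewrite (@transfer_sumE s t stP f y K); last by move=> x ty; exact: tK ty yK'.
  by rewrite mulr_suml; apply: eq_bigr => x _; case: ifP => // _; rewrite mul0r.
rewrite exchange_big; apply: eq_big_seq => x xK /=.
have tsP y z : t y = Some z <-> s z = Some y by split=> /stP.
rewrite (@transfer_sumE t s tsP g x K'); last by move=> y sx; exact: sK sx xK.
rewrite mulr_sumr; apply: eq_bigr => y _.
have -> : (s x == Some y) = (t y == Some x) by apply/eqP/eqP => /stP.
by case: ifP => // _; rewrite mulr0.
Qed.

(** By [transfer_sum_adj] the sum over K becomes a sum of f^2 over those points of t(K), each
    occurring once since the map is injective. *)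
Lemma transfer_square_summable (s t : X -> option X) (f : l2) :
  (forall x y, s x = Some y <-> t y = Some x) ->
  forall K, \sum_(y <- K) transfer t f y ^+ 2 <= l2ip f f.
Proof.
move=> stP K; pose A : {fset X} := [fset y in pmap t K]%fset.
apply: le_trans (l2ip_sum_le f A); under eq_bigr => y _ do rewrite expr2.
rewrite (@transfer_sum_adj s t _ _ A K) //.
- apply: ler_sum => x _; rewrite {1}/transfer; case sx : (s x) => [y|].
    by rewrite /transfer (iffLR (stP _ _) sx) -expr2.
  by rewrite mulr0 sqr_ge0.
- by move=> x y ty yK; apply/opt_imageP; exists y.
- move=> x y /stP ty /opt_imageP[y' y'K ty'].
  by move: ty' => /stP; move/stP: ty => -> [->].
Qed.

(* The partial isometry of l2(X) moving the basis along the partial injection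
   with inverse [t]. *)
Definition l2transfer (s t : X -> option X)
    (stP : forall x y, s x = Some y <-> t y = Some x) (f : l2) : l2 :=
  L2 (asboolT (ex_intro _ _ (transfer_square_summable f stP))).

Lemma l2transfer_adj (s t : X -> option X) stP tsP (f g : l2) :
  l2ip (@l2transfer s t stP f) g = l2ip f (@l2transfer t s tsP g).
Proof.
apply: l2ip_unique; apply/cvgrPdist_lt => e e0.
have /cvgrPdist_lt /(_ e e0)[A0 _ A0e] := @l2ip_cvg f (l2transfer tsP g).
(* Any B containing the image of A0 is matched with A0 together with t(B), which lies beyond A0 and
   so is already within e of the limit. *)
exists [fset y in pmap s A0]%fset => // B /= /fsubsetP sB.
have := A0e (A0 `|` [fset y in pmap t B])%fset; rewrite /= fsubsetUl => /(_ isT).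
rewrite -(@transfer_sum_adj s t _ _ _ B) //.
- by move=> x y ty yB; rewrite inE; apply/orP; right; apply/opt_imageP; exists y.
- move=> x y sx; rewrite inE => /orP[xA0|/opt_imageP[y' y'B /stP]].
    by apply: sB; apply/opt_imageP; exists x.
  by rewrite sx => -[->].
Qed.

Definition delta (y : X) : l2.
Proof.
apply: (@L2 (fun x => if x == y then 1 else 0)); apply/asboolP; exists 1 => K.
have [yK|yK] := boolP (y \in K).
  rewrite (big_fsetD1 y) //= eqxx expr1n big1_seq ?addr0 // => x /andP[_].
  by rewrite !inE => /andP[/negbTE -> _]; rewrite expr0n.
rewrite big1_seq ?ler01 // => x /andP[_ xK]; case: eqP => [xy|_].
  by move: yK; rewrite -xy xK.
by rewrite expr0n.
Defined.

Lemma deltaE y x : delta y x = if x == y then 1 else 0.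
Proof. by []. Qed.

Lemma l2ip_delta (f : l2) y : l2ip f (delta y) = f y.
Proof.
apply: l2ip_unique; apply/cvgrPdist_lt => e e0.
exists [fset y]%fset => // K /=; rewrite fsub1set => yK.
rewrite (big_fsetD1 y) //= eqxx mulr1 big1_seq ?addr0 ?subrr ?normr0 // => x /andP[_].
by rewrite !inE => /andP[/negbTE -> _]; rewrite mulr0.
Qed.

End SquareSummable.

(** * Bounded operators *)

(* A complex Hilbert space seen as a real one: [ip] is the real part of the
   inner product and [cJ] is multiplication by the imaginary unit. *)
Record hilbert (R : realType) := Hilbert {
  hcar :> lmodType R;
  ip : hcar -> hcar -> R;
  cJ : hcar -> hcar;
  ipDl : forall x y z, ip (x + y) z = ip x z + ip y z;
  ipZl : forall a x z, ip (a *: x) z = a * ip x z;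
  ipC : forall x y, ip x y = ip y x;
  ip_ge0 : forall x, 0 <= ip x x;
  ip_eq0 : forall x, ip x x = 0 -> x = 0;
  cJK : forall x, cJ (cJ x) = - x;
  ipJl : forall x y, ip (cJ x) y = - ip x (cJ y);
  hcomplete : forall F : set_system hcar, ProperFilter F ->
    (forall e, 0 < e -> exists2 A, F A &
      forall x y, A x -> A y -> ip (x - y) (x - y) <= e) ->
    exists l, forall e, 0 < e -> F [set x | ip (x - l) (x - l) <= e]
}.

(** If a were positive, e = 1 would force c > 0, and then e = a / (2 c) would give a <= a / 2. *)
Lemma le0_eps (R : realType) (a c : R) : (forall e, 0 < e -> a <= e * c) -> a <= 0.
Proof.
move=> ae; rewrite leNgt; apply/negP => a0.
have c0 : 0 < c by have := lt_le_trans a0 (ae 1 ltr01); rewrite mul1r.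
have := ae (a / c / 2); rewrite !divr_gt0 // => /(_ isT).
have -> : a / c / 2 * c = a / 2 by field; rewrite gt_eqF.
by lra.
Qed.

Section HilbertTheory.
Variables (R : realType) (H : hilbert R).
Implicit Types (x y z : H).

Lemma ipDr x y z : ip x (y + z) = ip x y + ip x z.
Proof. by rewrite ipC ipDl ![ip _ x]ipC. Qed.

Lemma ipZr a x y : ip x (a *: y) = a * ip x y.
Proof. by rewrite ipC ipZl ipC. Qed.

Lemma ipNl x y : ip (- x) y = - ip x y.
Proof. by rewrite -scaleN1r ipZl mulN1r. Qed.

Lemma ipNr x y : ip x (- y) = - ip x y.
Proof. by rewrite ipC ipNl ipC. Qed.

Lemma ip0l y : ip 0 y = 0.
Proof. by rewrite -(scale0r (0 : H)) ipZl mul0r. Qed.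

Lemma ip_ext x y : (forall z, ip x z = ip y z) -> x = y.
Proof.
by move=> xy; apply/subr0_eq/ip_eq0; rewrite ipDl ipNl xy subrr.
Qed.

Lemma ip_extr x y : (forall z, ip z x = ip z y) -> x = y.
Proof. by move=> xy; apply: ip_ext => z; rewrite ipC xy ipC. Qed.

Lemma ipJr x y : ip x (cJ y) = - ip (cJ x) y.
Proof. by rewrite ipJl opprK. Qed.

(** Linearity comes from moving [cJ] to the other side of the inner product; the same argument makes
    every operator with an adjoint linear ([opD], [opZ]). *)
Lemma cJD x y : cJ (x + y) = cJ x + cJ y.
Proof. by apply: ip_ext => z; rewrite ipJl !ipDl !ipJl opprD. Qed.

Lemma cJZ a x : cJ (a *: x) = a *: cJ x.
Proof. by apply: ip_ext => z; rewrite ipJl !ipZl ipJl mulrN. Qed.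

Lemma cJN x : cJ (- x) = - cJ x.
Proof. by rewrite -scaleN1r cJZ scaleN1r. Qed.

Lemma ipJ0 x : ip x (cJ x) = 0.
Proof. by have := ipJr x x; rewrite [ip (cJ x) x]ipC; lra. Qed.

Definition nrm x : R := Num.sqrt (ip x x).

Lemma nrm_ge0 x : 0 <= nrm x. Proof. exact: sqrtr_ge0. Qed.

Lemma nrm_sq x : nrm x ^+ 2 = ip x x. Proof. exact/sqr_sqrtr/ip_ge0. Qed.

Lemma nrm_eq0 x : nrm x = 0 -> x = 0.
Proof. by move=> x0; apply: ip_eq0; rewrite -nrm_sq x0 expr0n. Qed.

Lemma nrm0 : nrm 0 = 0.
Proof. by rewrite /nrm ip0l sqrtr0. Qed.

Lemma nrm_le x a : 0 <= a -> (nrm x <= a) = (ip x x <= a ^+ 2).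
Proof. by move=> a0; rewrite -nrm_sq ler_pXn2r // nnegrE // nrm_ge0. Qed.

Lemma cauchy_schwarz x y : ip x y <= nrm x * nrm y.
Proof.
have [ixy|ixy] := leP (ip x y) 0.
  by apply: le_trans ixy _; rewrite mulr_ge0 // nrm_ge0.
rewrite -(@ler_pXn2r _ 2) ?nnegrE ?mulr_ge0 ?nrm_ge0 ?(ltW ixy) //.
rewrite exprMn !nrm_sq.
have [yy|yy] := eqVneq (ip y y) 0.
  by move: ixy; rewrite (ip_eq0 yy) ipC ip0l ltxx.
have yy0 : 0 < ip y y by rewrite lt_def yy ip_ge0.
(* The squared norm of this vector is <y, y> times <x, x><y, y> - <x, y>^2. *)
have := ip_ge0 (ip y y *: x - ip x y *: y).
rewrite !(ipDl, ipDr, ipNl, ipNr, ipZl, ipZr) (ipC y x) => h.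
rewrite -subr_ge0 -(pmulr_rge0 _ yy0); move: h; congr (0 <= _); ring.
Qed.

Lemma ip_norm_le x y : `|ip x y| <= nrm x * nrm y.
Proof.
have [_|_] := ger0P (ip x y); first exact: cauchy_schwarz.
have := cauchy_schwarz (- x) y; rewrite ipNl.
by congr (_ <= _ * _); rewrite /nrm ipNl ipNr opprK.
Qed.

Lemma nrmD x y : nrm (x + y) <= nrm x + nrm y.
Proof.
rewrite nrm_le ?addr_ge0 ?nrm_ge0 // sqrrD !nrm_sq ipDl !ipDr (ipC y x).
by have := cauchy_schwarz x y; lra.
Qed.

Lemma nrmN x : nrm (- x) = nrm x.
Proof. by rewrite /nrm ipNl ipNr opprK. Qed.

Lemma nrmB x y : nrm (x - y) = nrm (y - x).
Proof. by rewrite -nrmN opprB. Qed.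

Lemma nrmJ x : nrm (cJ x) = nrm x.
Proof. by rewrite /nrm ipJl cJK ipNr opprK. Qed.

Lemma nrm_triangle y x z : nrm (x - z) <= nrm (x - y) + nrm (y - z).
Proof. by apply: le_trans (nrmD _ _); rewrite addrA subrK. Qed.

Definition cscale (c : R[i]) x : H := complex.Re c *: x + complex.Im c *: cJ x.

Lemma nrm_cscale c x : nrm (cscale c x) = normc c * nrm x.
Proof.
case: c => a b; rewrite /cscale /nrm /= -sqrtrM ?addr_ge0 ?sqr_ge0 //.
congr Num.sqrt; rewrite !(ipDl, ipDr, ipZl, ipZr) (ipJl x (cJ x)) cJK ipNr opprK.
by rewrite (ipC (cJ x) x) ipJ0; ring.
Qed.

Lemma cscaleA c d x : cscale c (cscale d x) = cscale (c * d) x.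
Proof.
case: c d => a b [c d]; apply: ip_ext => z; rewrite /cscale /= cJD !cJZ cJK.
by rewrite !(ipDl, ipZl, ipNl); ring.
Qed.

Lemma cscaleDl c d x : cscale (c + d) x = cscale c x + cscale d x.
Proof.
case: c d => a b [c d]; apply: ip_ext => z; rewrite /cscale /=.
by rewrite !(ipDl, ipZl, ipNl); ring.
Qed.

Lemma cscaleDr c x y : cscale c (x + y) = cscale c x + cscale c y.
Proof. by rewrite /cscale cJD !scalerDr addrACA. Qed.

Lemma cscale1 x : cscale 1 x = x.
Proof. by rewrite /cscale /= scale1r scale0r addr0. Qed.

Lemma cscaleJ c x : cscale c (cJ x) = cJ (cscale c x).
Proof. by rewrite /cscale cJD !cJZ. Qed.

Lemma ip_cscale c x y : ip (cscale c x) y = ip x (cscale (conjc c) y).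
Proof.
case: c => a b; rewrite /cscale /= !(ipDl, ipDr, ipZl, ipZr) ipJl.
by ring.
Qed.

(* Conjugate-linear in the second argument. *)
Definition cip x y : R[i] := Complex (ip x y) (ip x (cJ y)).

Lemma cip_cscale c x y : cip (cscale c x) y = c * cip x y.
Proof.
case: c => a b; rewrite /cip /cscale /= !(ipDl, ipZl) !ipJl cJK ipNr opprK.
by apply/eqP; rewrite eq_complex /=; apply/andP; split; apply/eqP; ring.
Qed.

Lemma cipDl x y z : cip (x + y) z = cip x z + cip y z.
Proof. by rewrite /cip !ipDl. Qed.

(** A crude constant: the real and imaginary parts are each bounded by [nrm x * nrm y]. It only
    serves to pass to limits, where any uniform constant does. *)
Lemma normc_cip_le x y : normc (cip x y) <= 2 * (nrm x * nrm y).
Proof.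
have n0 : 0 <= nrm x * nrm y by rewrite mulr_ge0 ?nrm_ge0.
rewrite /= -(@ler_pXn2r _ 2) ?nnegrE ?sqrtr_ge0 ?mulr_ge0 ?nrm_ge0 //.
rewrite sqr_sqrtr ?addr_ge0 ?sqr_ge0 //.
have := ip_norm_le x y; have := ip_norm_le x (cJ y).
rewrite nrmJ !ler_norml => /andP[? ?] /andP[? ?].
by nra.
Qed.

Lemma cip_adj x y : cip y x = conjc (cip x y).
Proof. by rewrite /cip /= ipC -(ipC (cJ x)) ipJl. Qed.

End HilbertTheory.

Arguments cscale : simpl never.

(** Carrying the adjoint as data yields real linearity, and commuting with [cJ] makes it complex.
    The adjoint is determined by the operator, so equality is pointwise ([bop_ext]). *)
Record bop (R : realType) (H : hilbert R) := Bop {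
  op :> H -> H;
  adj : H -> H;
  op_adj : forall x y, ip (op x) y = ip x (adj y);
  opJ : forall x, op (cJ x) = cJ (op x);
  op_bounded : exists M, forall x, nrm (op x) <= M * nrm x
}.

HB.instance Definition _ (R : realType) (H : hilbert R) := gen_eqMixin (bop H).
HB.instance Definition _ (R : realType) (H : hilbert R) := gen_choiceMixin (bop H).

Section BoundedOperators.
Variables (R : realType) (H : hilbert R).
Implicit Types (S T U : bop H) (x y z : H) (c d : R[i]).

Lemma bop_ext S T : (forall x, S x = T x) -> S = T.
Proof.
case: S T => [s s' sa sJ sb] [t t' ta tJ tb] /= /funext st; subst t.
have st' : s' = t' by apply/funext => y; apply: ip_extr => z; rewrite -sa ta.
by subst t'; congr Bop; exact: Prop_irrelevance.
Qed.

Lemma opD T x y : T (x + y) = T x + T y.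
Proof. by apply: ip_ext => z; rewrite op_adj !ipDl !op_adj. Qed.

Lemma opZ T (a : R) x : T (a *: x) = a *: T x.
Proof. by apply: ip_ext => z; rewrite op_adj !ipZl op_adj. Qed.

Lemma op0 T : T 0 = 0.
Proof. by rewrite -(scale0r (0 : H)) opZ !scale0r. Qed.

Lemma op_cscale T c x : T (cscale c x) = cscale c (T x).
Proof. by rewrite /cscale opD !opZ opJ. Qed.

(** Requiring 0 <= M bounds the set from below even on the zero space. *)
Definition opn T : R :=
  inf [set M | 0 <= M /\ forall x, nrm (T x) <= M * nrm x].

Lemma opn_has_inf T : has_inf [set M | 0 <= M /\ forall x, nrm (T x) <= M * nrm x].
Proof.
have [M TM] := op_bounded T; split; last by exists 0 => M' [].
exists `|M|; split=> // x; apply: le_trans (TM x) _.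
by rewrite ler_wpM2r ?nrm_ge0 // ler_norm.
Qed.

Lemma opn_ge0 T : 0 <= opn T.
Proof.
by apply: lb_le_inf; [exact: (opn_has_inf T).1|by move=> M []].
Qed.

Lemma opn_ub T M : 0 <= M -> (forall x, nrm (T x) <= M * nrm x) -> opn T <= M.
Proof. by move=> M0 TM; apply: ge_inf => //; exact: (opn_has_inf T).2. Qed.

Lemma op_le T x : nrm (T x) <= opn T * nrm x.
Proof.
have [x0|] := eqVneq (nrm x) 0; first by rewrite (nrm_eq0 x0) op0 nrm0 mulr0.
move=> x0; have {}x0 : 0 < nrm x by rewrite lt_def x0 nrm_ge0.
rewrite -ler_pdivrMr //; apply: lb_le_inf; first exact: (opn_has_inf T).1.
by move=> M [_ TM]; rewrite ler_pdivrMr.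
Qed.

Lemma adjJ T y : adj T (cJ y) = cJ (adj T y).
Proof. by apply: ip_extr => z; rewrite -op_adj !ipJr -op_adj opJ. Qed.

(** The square of [nrm (adj T y)] is [ip (T (adj T y)) y]; Cauchy-Schwarz leaves one factor
    [nrm (adj T y)] to cancel. *)
Lemma adj_bounded T : exists M, forall x, nrm (adj T x) <= M * nrm x.
Proof.
exists (opn T) => y; have [->|y0] := eqVneq (nrm (adj T y)) 0.
  by rewrite mulr_ge0 // ?opn_ge0 ?nrm_ge0.
have {}y0 : 0 < nrm (adj T y) by rewrite lt_def y0 nrm_ge0.
rewrite -(ler_pM2r y0) -expr2 nrm_sq -op_adj; apply: le_trans (cauchy_schwarz _ _) _.
by rewrite mulrAC ler_wpM2r ?nrm_ge0 // op_le.
Qed.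

Lemma adj_op T x y : ip (adj T x) y = ip x (T y).
Proof. by rewrite ipC -op_adj ipC. Qed.

Definition bstar T := Bop (adj_op T) (adjJ T) (adj_bounded T).

Lemma bstarK T : bstar (bstar T) = T.
Proof. exact: bop_ext. Qed.

Definition bmul S T : bop H.
Proof.
apply: (@Bop _ _ (S \o T) (adj T \o adj S)) => [x y|x|] /=.
- by rewrite !op_adj.
- by rewrite !opJ.
- exists (opn S * opn T) => x; apply: le_trans (op_le _ _) _.
  by rewrite -mulrA ler_wpM2l ?opn_ge0 // op_le.
Defined.

Definition badd S T : bop H.
Proof.
apply: (@Bop _ _ (fun x => S x + T x) (fun x => adj S x + adj T x)) => [x y|x|].
- by rewrite ipDl ipDr !op_adj.
- by rewrite !opJ cJD.
- exists (opn S + opn T) => x; apply: le_trans (nrmD _ _) _.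
  by rewrite mulrDl lerD // op_le.
Defined.

Definition bscale c T : bop H.
Proof.
apply: (@Bop _ _ (fun x => cscale c (T x)) (fun x => cscale (conjc c) (adj T x))) => [x y|x|].
- by rewrite ip_cscale op_adj; congr ip; exact: (op_cscale (bstar T)).
- by rewrite opJ cscaleJ.
- exists (normc c * opn T) => x; rewrite nrm_cscale -mulrA ler_wpM2l ?op_le //.
  by case: c => a b; exact: sqrtr_ge0.
Defined.

Definition bzero : bop H.
Proof.
apply: (@Bop _ _ (fun => 0) (fun => 0)) => [x y|x|].
- by rewrite /= ip0l ipC ip0l.
- by rewrite -(scale0r (0 : H)) cJZ !scale0r.
- by exists 0 => x; rewrite nrm0 mul0r.
Defined.

Lemma baddA : associative badd.
Proof. by move=> S T U; apply: bop_ext => x; exact: addrA. Qed.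
Lemma baddC : commutative badd.
Proof. by move=> S T; apply: bop_ext => x; exact: addrC. Qed.
Lemma badd0 : left_id bzero badd.
Proof. by move=> S; apply: bop_ext => x; exact: add0r. Qed.

Lemma cscaleN1 x : cscale (-1) x = - x.
Proof. by rewrite /cscale /= oppr0 scale0r addr0 scaleN1r. Qed.

Lemma baddN : left_inverse bzero (bscale (-1)) badd.
Proof. by move=> S; apply: bop_ext => x /=; rewrite cscaleN1 addNr. Qed.

HB.instance Definition _ := GRing.isZmodule.Build (bop H) baddA baddC badd0 baddN.

Lemma bopDE S T x : (S + T) x = S x + T x. Proof. by []. Qed.

Lemma bscaleA c d T : bscale c (bscale d T) = bscale (c * d) T.
Proof. by apply: bop_ext => x; exact: cscaleA. Qed.
Lemma bscale1 : left_id 1 bscale.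
Proof. by move=> T; apply: bop_ext => x; exact: cscale1. Qed.
Lemma bscaleDr : right_distributive bscale +%R.
Proof. by move=> c S T; apply: bop_ext => x; exact: cscaleDr. Qed.
Lemma bscaleDl T : {morph bscale^~ T : c d / c + d}.
Proof. by move=> c d; apply: bop_ext => x; exact: cscaleDl. Qed.

HB.instance Definition _ := GRing.Zmodule_isLmodule.Build R[i] (bop H)
  bscaleA bscale1 bscaleDr bscaleDl.

Lemma bopZE c T x : (c *: T) x = cscale c (T x). Proof. by []. Qed.
Lemma bopNE T x : (- T) x = - T x. Proof. exact: cscaleN1. Qed.
Lemma opnD S T : opn (S + T) <= opn S + opn T.
Proof.
apply: opn_ub => [|x]; first by rewrite addr_ge0 // opn_ge0.
by apply: le_trans (nrmD _ _) _; rewrite mulrDl lerD // op_le.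
Qed.

Lemma normc_ge0 c : 0 <= normc c.
Proof. by case: c => a b; exact: sqrtr_ge0. Qed.

Lemma opnZ_le c T : opn (c *: T) <= normc c * opn T.
Proof.
apply: opn_ub => [|x]; first by rewrite mulr_ge0 ?normc_ge0 ?opn_ge0.
by rewrite nrm_cscale -mulrA ler_wpM2l ?normc_ge0 // op_le.
Qed.

Lemma opnZ c T : opn (c *: T) = normc c * opn T.
Proof.
apply/eqP; rewrite eq_le opnZ_le /=; have [->|c0] := eqVneq c 0.
  by rewrite normc0 mul0r opn_ge0.
have nc0 : 0 < normc c.
  by rewrite lt_def normc_ge0 andbT; apply: contra c0 => /eqP /eq0_normc ->.
rewrite mulrC -ler_pdivlMr // mulrC -normcV.
by rewrite -{1}[T]scale1r -(mulVf c0) -scalerA opnZ_le.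
Qed.

Lemma opn_eq0 T : opn T = 0 -> T = 0.
Proof.
move=> T0; apply: bop_ext => x; apply: nrm_eq0; apply/eqP.
by rewrite eq_le nrm_ge0 andbT -(mul0r (nrm x)) -T0 op_le.
Qed.

Definition bnorm T : R[i] := (opn T)%:C.

Lemma bnormD S T : bnorm (S + T) <= bnorm S + bnorm T.
Proof. by rewrite /bnorm -rmorphD lecR opnD. Qed.

Lemma bnormZ c T : bnorm (c *: T) = `|c| * bnorm T.
Proof.
by rewrite /bnorm opnZ rmorphM.
Qed.

Lemma bnorm_eq0 T : bnorm T = 0 -> T = 0.
Proof. by case=> T0; exact: opn_eq0. Qed.

HB.instance Definition _ := Lmodule_isNormed.Build R[i] (bop H) bnormD bnormZ bnorm_eq0.

Lemma bop_normE T : `|T| = (opn T)%:C. Proof. by []. Qed.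

Lemma opn_star_le T : opn (bstar T) <= opn T.
Proof.
apply: opn_ub => [|y /=]; first exact: opn_ge0.
have [->|y0] := eqVneq (nrm (adj T y)) 0.
  by rewrite mulr_ge0 // ?opn_ge0 ?nrm_ge0.
have {}y0 : 0 < nrm (adj T y) by rewrite lt_def y0 nrm_ge0.
rewrite -(ler_pM2r y0) -expr2 nrm_sq -op_adj; apply: le_trans (cauchy_schwarz _ _) _.
by rewrite mulrAC ler_wpM2r ?nrm_ge0 // op_le.
Qed.

Lemma opn_star T : opn (bstar T) = opn T.
Proof.
by apply/eqP; rewrite eq_le opn_star_le -{1}[T]bstarK opn_star_le.
Qed.

Lemma opn_mul S T : opn (bmul S T) <= opn S * opn T.
Proof.
apply: opn_ub => [|x]; first by rewrite mulr_ge0 ?opn_ge0.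
by apply: le_trans (op_le S (T x)) _; rewrite -mulrA ler_wpM2l ?opn_ge0 // op_le.
Qed.

Lemma opn_star_mul T : opn (bmul (bstar T) T) = opn T ^+ 2.
Proof.
apply/eqP; rewrite eq_le {1}expr2 -{1}(opn_star T) opn_mul /=.
have n0 : 0 <= Num.sqrt (opn (bmul (bstar T) T)) by exact: sqrtr_ge0.
rewrite -[leRHS](sqr_sqrtr (opn_ge0 _)) ler_pXn2r ?nnegrE ?opn_ge0 //.
apply: opn_ub => // x; rewrite nrm_le; last by rewrite mulr_ge0 ?nrm_ge0.
rewrite exprMn sqr_sqrtr ?opn_ge0 // op_adj expr2 mulrA ipC.
apply: le_trans (cauchy_schwarz _ _) _.
by rewrite ler_wpM2r ?nrm_ge0 // (op_le (bmul (bstar T) T)).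
Qed.

Section Completeness.
Variable F : set_system (bop H).
Hypothesis FF : ProperFilter F.
Hypothesis cauchyF : forall e, 0 < e ->
  exists2 A, F A & forall S T, A S -> A T -> opn (S - T) <= e.

Lemma bop_pointwise_lim (D : set_system (bop H)) x : ProperFilter D ->
  (forall e, 0 < e -> exists2 A, D A & forall S T, A S -> A T -> opn (S - T) <= e) ->
  exists l, forall e, 0 < e -> D [set T | nrm (T x - l) <= e].
Proof.
move=> DD cD.
have [] := @hcomplete _ H ((fun T : bop H => T x) @ D) _.
  (* The square root appears because [hcomplete] measures squared norms; the summand 1 avoids a
     division by zero. *)
  move=> e e0; pose d := Num.sqrt e / (nrm x + 1).
  have x1 : 0 < nrm x + 1 by rewrite ltr_wpDl // nrm_ge0.
  have [|A DA Ad] := cD d; first by rewrite divr_gt0 // sqrtr_gt0.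
  exists [set y | exists2 T, A T & y = T x].
    by apply: (@filterS _ D _ A _ _ DA) => T AT; exists T.
  move=> _ _ [S AS ->] [T AT ->]; rewrite -(sqr_sqrtr (ltW e0)) -nrm_le ?sqrtr_ge0 //.
  rewrite -bopNE -bopDE; apply: (le_trans (op_le (S - T) x)).
  apply: (@le_trans _ _ (d * (nrm x + 1))); last by rewrite divfK // gt_eqF.
  by apply: ler_pM; rewrite ?opn_ge0 ?nrm_ge0 ?Ad // lerDl.
move=> l lP; exists l => e e0; have := lP (e ^+ 2).
rewrite exprn_gt0 // => /(_ isT) De.
apply: (@filterS _ D _ ((fun T : bop H => T x) @^-1` _) _ _ De) => T /=.
by rewrite -nrm_le // ltW.
Qed.

Lemma bop_lim_le (D : set_system (bop H)) e (A : set (bop H)) T x l :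
  ProperFilter D -> D A -> (forall S T, A S -> A T -> opn (S - T) <= e) -> A T ->
  (forall e, 0 < e -> D [set T | nrm (T x - l) <= e]) ->
  nrm (T x - l) <= e * nrm x.
Proof.
move=> DD DA Ae AT lP; apply/ler_addgt0Pr => d d0.
have [S [AS Sd]] := filter_ex (filterI DA (lP d d0)).
apply: le_trans (nrm_triangle (S x) _ _) _; apply: lerD; last exact: Sd.
rewrite -bopNE -bopDE; apply: (le_trans (op_le (T - S) x)).
by rewrite ler_wpM2r ?nrm_ge0 // Ae.
Qed.

Lemma opnB S T : opn (S - T) = opn (T - S).
Proof.
by rewrite -[S - T]opprB -scaleN1r opnZ /= oppr0 expr0n addr0 sqrrN expr1n sqrtr1 mul1r.
Qed.

Lemma bstarB S T : bstar (S - T) = bstar S - bstar T.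
Proof.
apply: bop_ext => x; rewrite bopDE bopNE.
by rewrite -[LHS]/(adj S x + cscale (conjc (-1)) (adj T x)) rmorphN1 cscaleN1.
Qed.

(** Pointwise limits are taken of the operators and of their adjoints, since both are part of the
    limit operator. The Cauchy bound is uniform on vectors, so one approximant T controls both
    limits at once and every field passes to the limit. *)
Lemma bop_complete :
  exists L : bop H, forall e, 0 < e -> F [set T | opn (L - T) <= e].
Proof.
have [l lP] := choice (fun x => bop_pointwise_lim x FF cauchyF).
have sFF : ProperFilter (bstar @ F) by exact: fmap_proper_filter.
have cauchysF e : 0 < e ->
    exists2 A, (bstar @ F) A & forall S T, A S -> A T -> opn (S - T) <= e.
  move=> /cauchyF[A FA Ae]; exists (bstar @` A).
    by apply: (@filterS _ F _ A _ _ FA) => T AT; exists T.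
  by move=> _ _ [S AS <-] [T AT <-]; rewrite -bstarB opn_star; exact: Ae.
have [l' l'P] := choice (fun x => bop_pointwise_lim x sFF cauchysF).
have approx e : 0 < e -> exists2 A, F A & forall T, A T ->
    (forall x, nrm (T x - l x) <= e * nrm x) /\
    (forall x, nrm (adj T x - l' x) <= e * nrm x).
  move=> /cauchyF[A FA Ae]; exists A => // T AT; split=> x.
    exact: (bop_lim_le FF FA Ae AT (lP x)).
  have FsA : (bstar @ F) (bstar @` A).
    by apply: (@filterS _ F _ A _ _ FA) => S AS; exists S.
  apply: (bop_lim_le (T := bstar T) sFF FsA _ _ (l'P x)); last by exists T.
  by move=> _ _ [S AS <-] [S' AS' <-]; rewrite -bstarB opn_star; exact: Ae.
have approx1 e : 0 < e -> exists T,
    (forall x, nrm (T x - l x) <= e * nrm x) /\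
    (forall x, nrm (adj T x - l' x) <= e * nrm x).
  by move=> /approx[A /filter_ex[T AT] /(_ T AT)]; exists T.
have l_adj x y : ip (l x) y = ip x (l' y).
  apply/subr0_eq/eqP; rewrite -normr_le0.
  apply: (@le0_eps _ _ (2 * (nrm x * nrm y))) => e /approx1[T [Tl Tl']].
  have -> : ip (l x) y - ip x (l' y) = ip x (adj T y - l' y) - ip (T x - l x) y.
    by rewrite ipDl ipDr ipNl ipNr op_adj; ring.
  apply: le_trans (ler_normB _ _) _.
  have := le_trans (ip_norm_le x (adj T y - l' y)) (ler_wpM2l (nrm_ge0 x) (Tl' y)).
  have := le_trans (ip_norm_le (T x - l x) y) (ler_wpM2r (nrm_ge0 y) (Tl x)).
  by lra.
have lJ x : l (cJ x) = cJ (l x).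
  apply/subr0_eq/nrm_eq0/eqP; rewrite eq_le nrm_ge0 andbT.
  apply: (@le0_eps _ _ (2 * nrm x)) => e /approx1[T [Tl _]].
  apply: le_trans (nrm_triangle (T (cJ x)) _ _) _; rewrite nrmB.
  have := Tl x; rewrite -nrmJ cJD cJN -opJ => h.
  by have := Tl (cJ x); rewrite nrmJ; lra.
have l_bounded : exists M, forall x, nrm (l x) <= M * nrm x.
  have [T [Tl _]] := approx1 1 ltr01; exists (opn T + 1) => x.
  have := nrm_triangle (T x) (l x) 0; rewrite !subr0 [nrm (l x - _)]nrmB.
  by have := Tl x; have := op_le T x; lra.
exists (Bop l_adj lJ l_bounded) => e e0; have [A FA Ae] := approx e e0.
apply: (filterS _ FA) => T /Ae[Tl _]; rewrite /= opnB.
apply: opn_ub => [|x]; first exact: ltW.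
by rewrite bopDE bopNE.
Qed.

End Completeness.

Lemma bop_cauchy_cvg (F : set_system (bop H)) : ProperFilter F -> cauchy F -> cvg F.
Proof.
move=> FF /cauchy_ballP cF.
have [|L LP] := @bop_complete F FF.
  move=> e e0; have e0' : (0 : R[i]) < e%:C by rewrite ltcR.
  have [[A B] /= [FA FB] AB] := cF _ e0'.
  exists (A `&` B); first exact: filterI.
  move=> S T [AS _] [_ BT]; have := AB (S, T) (conj AS BT).
  by rewrite /= -ball_normE /= bop_normE ltcR => /ltW.
apply/cvg_ex; exists L; apply/cvgrPdist_le => /= -[e e'].
rewrite ltcE /= => /andP[/eqP -> e0]; apply: (@filterS _ F _ _ _ _ (LP e e0)) => T /=.
by rewrite bop_normE lecR.
Qed.

HB.instance Definition _ := Uniform_isComplete.Build (bop H) bop_cauchy_cvg.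

Lemma bmulA : associative bmul.
Proof. by move=> S T U; apply: bop_ext. Qed.
Lemma bmulDl : left_distributive bmul +%R.
Proof. by move=> S T U; apply: bop_ext. Qed.
Lemma bmulDr : right_distributive bmul +%R.
Proof. by move=> S T U; apply: bop_ext => x; exact: opD. Qed.
Lemma bmulZl c S T : bmul (c *: S) T = c *: bmul S T.
Proof. exact: bop_ext. Qed.
Lemma bmulZr c S T : bmul S (c *: T) = c *: bmul S T.
Proof. by apply: bop_ext => x; exact: op_cscale. Qed.
Lemma bstarD : {morph bstar : S T / S + T}.
Proof. by move=> S T; apply: bop_ext. Qed.
Lemma bstarZ c S : bstar (c *: S) = Num.conj c *: bstar S.
Proof. exact: bop_ext. Qed.
Lemma bstarM S T : bstar (bmul S T) = bmul (bstar T) (bstar S).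
Proof. exact: bop_ext. Qed.
Lemma bnormM S T : `|bmul S T| <= `|S| * `|T|.
Proof. by rewrite !bop_normE -rmorphM lecR opn_mul. Qed.
Lemma bnorm_star S : `|bmul (bstar S) S| = `|S| ^+ 2.
Proof. by rewrite !bop_normE -rmorphXn /= opn_star_mul. Qed.

HB.instance Definition _ := isCStarAlgebra.Build R (bop H)
  bmulA bmulDl bmulDr bmulZl bmulZr bstarK bstarD bstarZ bstarM bnormM bnorm_star.

Lemma bopME S T x : (cmul S T : bop H) x = S (T x). Proof. by []. Qed.

End BoundedOperators.

(** * The complex Hilbert space l2(X) and its partial isometries *)

Section ComplexL2.
Variables (R : realType) (X : choiceType).
Local Notation V := (l2 R X * l2 R X)%type.

(** A pair consists of the real and imaginary parts of a complex function. *)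
Definition cl2_ip (u v : V) : R := l2ip u.1 v.1 + l2ip u.2 v.2.
Definition cl2_J (u : V) : V := (- u.2, u.1).

Lemma l2ipN (f g : l2 R X) : l2ip (- f) g = - l2ip f g.
Proof. by rewrite -scaleN1r l2ipZl mulN1r. Qed.

Lemma cl2_complete (F : set_system V) : ProperFilter F ->
  (forall e, 0 < e -> exists2 A, F A &
    forall x y, A x -> A y -> cl2_ip (x - y) (x - y) <= e) ->
  exists l, forall e, 0 < e -> F [set x | cl2_ip (x - l) (x - l) <= e].
Proof.
move=> FF cF.
have [|l1 l1P] := @l2_complete R X ((@fst _ _ : V -> l2 R X) @ F) _.
- move=> e /cF[A FA Ae]; exists (fst @` A).
    by apply: (@filterS _ F _ A _ _ FA) => u Au; exists u.
  move=> _ _ [u Au <-] [v Av <-]; apply: le_trans (Ae u v Au Av).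
  by rewrite lerDl l2ip_ge0.
have [|l2' l2P] := @l2_complete R X ((@snd _ _ : V -> l2 R X) @ F) _.
- move=> e /cF[A FA Ae]; exists (snd @` A).
    by apply: (@filterS _ F _ A _ _ FA) => u Au; exists u.
  move=> _ _ [u Au <-] [v Av <-]; apply: le_trans (Ae u v Au Av).
  by rewrite lerDr l2ip_ge0.
exists (l1, l2') => e e0; have e20 : 0 < e / 2 by rewrite divr_gt0.
have F1 : F [set u : V | l2ip (u.1 - l1) (u.1 - l1) <= e / 2] := l1P _ e20.
have F2 : F [set u : V | l2ip (u.2 - l2') (u.2 - l2') <= e / 2] := l2P _ e20.
apply: (filterS _ (filterI F1 F2)) => u /= [u1 u2].
by rewrite /cl2_ip [leRHS]splitr; exact: lerD.
Qed.

Definition cl2 : hilbert R.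
Proof.
apply: (@Hilbert R V cl2_ip cl2_J); last exact: cl2_complete.
- by move=> x y z; rewrite /cl2_ip /= !l2ipDl; ring.
- by move=> a x z; rewrite /cl2_ip /= !l2ipZl; ring.
- by move=> x y; rewrite /cl2_ip [in LHS]l2ipC [l2ip x.2 _]l2ipC.
- by move=> x; rewrite /cl2_ip addr_ge0 // l2ip_ge0.
- move=> [f g] /eqP; rewrite /cl2_ip /= paddr_eq0 ?l2ip_ge0 //.
  by move=> /andP[/eqP/l2ip_eq0 -> /eqP/l2ip_eq0 ->].
- by move=> [f g].
- move=> [f g] [h k]; rewrite /cl2_ip /= l2ipN [l2ip f (- k)]l2ipC l2ipN.
  by rewrite [l2ip k f]l2ipC; ring.
Defined.

Definition coord (u : cl2) (y : X) (b : bool) : R := if b then u.1 y else u.2 y.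

Lemma coord_ext (u v : cl2) : (forall y b, coord u y b = coord v y b) -> u = v.
Proof.
case: u v => [f g] [h k] uv.
by congr pair; apply: l2_inj => y; [exact: (uv y true)|exact: (uv y false)].
Qed.

Lemma coordD (u v : cl2) y b : coord (u + v) y b = coord u y b + coord v y b.
Proof. by case: b. Qed.

Lemma coordN (u : cl2) y b : coord (- u) y b = - coord u y b.
Proof. by case: b. Qed.

Lemma coord0 y b : coord 0 y b = 0.
Proof. by case: b. Qed.

Lemma coordJ (u : cl2) y b :
  coord (cJ u) y b = if b then - coord u y false else coord u y true.
Proof. by case: b. Qed.

(** Keeping both directions makes the adjoint a swap and the product a composition, so relations
    between the resulting partial isometries reduce to equalities of backward maps ([ptr_ext]). *)
Record pinj := Pinj {
  fwd : X -> option X;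
  bwd : X -> option X;
  pinjP : forall x y, fwd x = Some y <-> bwd y = Some x
}.

Lemma pinjP_sym (r : pinj) x y : bwd r x = Some y <-> fwd r y = Some x.
Proof. by split=> /pinjP. Qed.

Definition ptr_fun (r : pinj) (u : cl2) : cl2 :=
  (l2transfer (@pinjP r) u.1, l2transfer (@pinjP r) u.2).

Definition pinj_inv (r : pinj) : pinj := Pinj (@pinjP_sym r).

Lemma ptr_fun_adj (r : pinj) (u v : cl2) : ip (ptr_fun r u) v = ip u (ptr_fun (pinj_inv r) v).
Proof. by congr (_ + _); exact: l2transfer_adj. Qed.

Lemma coord_ptr (r : pinj) u y b :
  coord (ptr_fun r u) y b = if bwd r y is Some x then coord u x b else 0.
Proof. by case: b. Qed.

Lemma ptr_funJ (r : pinj) (u : cl2) : ptr_fun r (cJ u) = cJ (ptr_fun r u).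
Proof.
apply: coord_ext => y b; rewrite coord_ptr coordJ !coord_ptr.
by case: (bwd r y) => [x|]; rewrite ?coordJ // oppr0 if_same.
Qed.

Lemma ptr_fun_bounded (r : pinj) : exists M, forall u, nrm (ptr_fun r u) <= M * nrm u.
Proof.
exists 1 => u; rewrite mul1r nrm_le ?nrm_ge0 // nrm_sq.
by apply: lerD; apply: l2ip_le => K; exact: (transfer_square_summable _ (@pinjP r)).
Qed.

Definition ptr (r : pinj) : bop cl2 :=
  Bop (ptr_fun_adj r) (ptr_funJ r) (ptr_fun_bounded r).

Lemma ptrE (r : pinj) u y b :
  coord (ptr r u) y b = if bwd r y is Some x then coord u x b else 0.
Proof. exact: coord_ptr. Qed.

Lemma bop_coord_ext (S T : bop cl2) :
  (forall u y b, coord (S u) y b = coord (T u) y b) -> S = T.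
Proof. by move=> ST; apply: bop_ext => u; apply: coord_ext => y b; exact: ST. Qed.

Lemma ptr_ext (r r' : pinj) : bwd r =1 bwd r' -> ptr r = ptr r'.
Proof. by move=> rr'; apply: bop_coord_ext => u y b; rewrite !ptrE rr'. Qed.

Lemma ptr_star (r : pinj) : star (ptr r) = ptr (pinj_inv r).
Proof. exact: bop_ext. Qed.

Lemma ptr_eq0 (r : pinj) : (forall y, bwd r y = None) -> ptr r = 0.
Proof. by move=> r0; apply: bop_coord_ext => u y b; rewrite ptrE r0 coord0. Qed.

Lemma pinj_compP (r r' : pinj) x y :
  obind (fwd r) (fwd r' x) = Some y <-> obind (bwd r') (bwd r y) = Some x.
Proof.
split.
  by case rx : (fwd r' x) => [z|//] /= /pinjP -> /=; apply/pinjP.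
by case ry : (bwd r y) => [z|//] /= /pinjP -> /=; apply/pinjP.
Qed.

Definition pinj_comp (r r' : pinj) : pinj := Pinj (pinj_compP r r').

Lemma ptr_mul (r r' : pinj) : cmul (ptr r) (ptr r') = ptr (pinj_comp r r').
Proof.
apply: bop_coord_ext => u y b; rewrite bopME !ptrE /=.
by case: (bwd r y) => //= z; rewrite ptrE.
Qed.

Definition restrict (S : set X) x := if `[< S x >] then Some x else None.

Lemma restrictP (S : set X) x y : restrict S x = Some y <-> restrict S y = Some x.
Proof.
rewrite /restrict; split; first by case: asboolP => // Sx [<-]; rewrite asboolT.
by case: asboolP => // Sx [<-]; rewrite asboolT.
Qed.

Definition pinj_id (S : set X) : pinj := Pinj (restrictP S).

Lemma restrict_in (S : set X) x : S x -> restrict S x = Some x.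
Proof. by move=> Sx; rewrite /restrict asboolT. Qed.

Lemma restrict_out (S : set X) x : ~ S x -> restrict S x = None.
Proof. by move=> Sx; rewrite /restrict asboolF. Qed.

Definition pid (S : set X) : bop cl2 := ptr (pinj_id S).

Lemma pidE S u y b : coord (pid S u) y b = if `[< S y >] then coord u y b else 0.
Proof. by rewrite ptrE /= /restrict; case: asboolP. Qed.

Lemma pid_star S : star (pid S) = pid S.
Proof. by rewrite ptr_star; apply: ptr_ext. Qed.

Lemma pidI S T : pid (S `&` T) = cmul (pid S) (pid T).
Proof.
rewrite ptr_mul; apply: ptr_ext => y /=; have [Sy|nS] := pselect (S y); last first.
  by rewrite [restrict S y]restrict_out // restrict_out // => -[].
rewrite [restrict S y]restrict_in //=; have [Ty|nT] := pselect (T y).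
  by rewrite !restrict_in.
by rewrite !restrict_out // => -[].
Qed.

Lemma pidU S T : pid (S `|` T) = pid S + pid T - pid (S `&` T).
Proof.
apply: bop_coord_ext => u y b; rewrite !bopDE bopNE !coordD coordN !pidE.
have -> : `[< (S `|` T) y >] = `[< S y >] || `[< T y >] by exact: asbool_or.
have -> : `[< (S `&` T) y >] = `[< S y >] && `[< T y >] by exact: asbool_and.
by case: `[< S y >]; case: `[< T y >]; rewrite /= ?subrr ?subr0 ?addr0 ?add0r // addrK.
Qed.

Lemma pid0 : pid set0 = 0.
Proof. by apply: ptr_eq0 => y; apply: restrict_out. Qed.

(** In each coordinate, disjointness leaves at most one non-zero summand. *)
Lemma pid_bigcup (I : choiceType) (D : set I) (F : I -> set X) :
  finite_set D -> trivIset D F ->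
  pid (\bigcup_(i in D) F i) = \sum_(i \in D) pid (F i).
Proof.
move=> finD trivF; rewrite fsbig_finite //; apply: bop_coord_ext => u y b.
rewrite (big_morph (fun T : bop cl2 => coord (T u) y b) (id1 := 0) (op1 := +%R)); first last.
- exact: coord0.
- by move=> S T; rewrite bopDE coordD.
under eq_bigr => i _ do rewrite pidE; rewrite pidE.
case: asboolP => [[i Di Fi]|nF]; last first.
  rewrite big1_seq // => i /andP[_]; rewrite in_fset_set // => /set_mem Di.
  by rewrite asboolF // => Fi; apply: nF; exists i.
rewrite (big_fsetD1 i) /=; last by rewrite in_fset_set // mem_set.
rewrite asboolT // big1_seq ?addr0 // => j /andP[_].
rewrite in_fsetD1 in_fset_set // => /andP[ji /set_mem Dj].
rewrite asboolF // => Fj; move/eqP: ji; apply.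
by apply: trivF => //; exists y.
Qed.

Definition cdelta (x : X) : cl2 := (delta R x, 0).

Lemma coord_delta x y b : coord (cdelta x) y b = if b && (y == x) then 1 else 0.
Proof. by case: b. Qed.

Lemma ptr_delta r x y : fwd r x = Some y -> ptr r (cdelta x) = cdelta y.
Proof.
move=> rx; apply: coord_ext => z b; rewrite ptrE coord_delta.
case rz : (bwd r z) => [t|].
  rewrite coord_delta; congr (if b && _ then _ else _); apply/eqP/eqP => [tx|zy].
    by move/pinjP: rz; rewrite tx rx => -[].
  by move: rz; rewrite zy; move/pinjP: rx => -> [].
have [zy|] := eqVneq z y; last by rewrite andbF.
by move: rz; rewrite zy; move/pinjP: rx => ->.
Qed.

Lemma ptr_delta0 r x : fwd r x = None -> ptr r (cdelta x) = 0.
Proof.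
move=> rx; apply: coord_ext => z b; rewrite ptrE coord0.
case rz : (bwd r z) => [t|//]; rewrite coord_delta; case: eqP => [tx|]; last by rewrite andbF.
by move/pinjP: rz; rewrite tx rx.
Qed.

Lemma cip_delta x : cip (cdelta x) (cdelta x) = 1.
Proof.
have z : l2ip (0 : l2 R X) 0 = 0 by rewrite -{1}(scale0r 0) l2ipZl mul0r.
have d1 : l2ip (delta R x) (delta R x) = 1 by rewrite l2ip_delta deltaE eqxx.
by rewrite /cip ipJ0 /= /cl2_ip /= d1 z addr0.
Qed.

End ComplexL2.

(** * Contractivity of *-homomorphisms *)

Section CStarNorm.
Variables (R : realType) (A : cstarAlgType R).
Implicit Types (x y z : A) (c : R[i]).
Local Open Scope cstar_scope.

Definition nr x : R := complex.Re `|x|.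

Lemma nrE x : `|x| = (nr x)%:C.
Proof.
by have := normr_ge0 x; rewrite /nr; case: `|x| => a b; rewrite lecE /= => /andP[/eqP ->].
Qed.

Lemma nr_ge0 x : 0 <= nr x.
Proof. by have := normr_ge0 x; rewrite nrE lecR. Qed.

Lemma nrD x y : nr (x + y) <= nr x + nr y.
Proof. by have := ler_normD x y; rewrite !nrE -rmorphD lecR. Qed.

Lemma nrN x : nr (- x) = nr x.
Proof. by rewrite /nr normrN. Qed.

Lemma nrB x y : nr (x - y) = nr (y - x).
Proof. by rewrite -nrN opprB. Qed.

Lemma nr_triangle y x z : nr (x - z) <= nr (x - y) + nr (y - z).
Proof. by apply: le_trans (nrD _ _); rewrite addrA subrK. Qed.

Lemma nrZ c x : nr (c *: x) = normc c * nr x.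
Proof. by apply: complexI; rewrite -nrE normrZ nrE rmorphM. Qed.

Lemma nr_eq0 x : nr x = 0 -> x = 0.
Proof. by move=> x0; apply/eqP; rewrite -normr_eq0 nrE x0. Qed.

Lemma nr0 : nr 0 = 0.
Proof. by apply: complexI; rewrite -nrE normr0. Qed.

Lemma nrM x y : nr (x ** y) <= nr x * nr y.
Proof. by have := cnormM x y; rewrite !nrE -rmorphM lecR. Qed.

Lemma nr_cstar x : nr (star x ** x) = nr x ^+ 2.
Proof. by apply: complexI; rewrite -nrE cnorm_star nrE rmorphXn. Qed.

(** The C*-identity and submultiplicativity give |x|^2 <= |x^*| |x|. *)
Lemma nr_star_ge x : nr x <= nr (star x).
Proof.
have [->|x0] := eqVneq (nr x) 0; first exact: nr_ge0.
have {}x0 : 0 < nr x by rewrite lt_def x0 nr_ge0.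
by rewrite -(ler_pM2r x0) -expr2 -nr_cstar nrM.
Qed.

Lemma nr_star x : nr (star x) = nr x.
Proof.
by apply/eqP; rewrite eq_le nr_star_ge andbT -{2}[x]starK nr_star_ge.
Qed.

Lemma cmul0l x : 0 ** x = 0 :> A.
Proof. by have := cmulZl 0 0 x; rewrite !scale0r. Qed.

Lemma cmul0r x : x ** 0 = 0 :> A.
Proof. by have := cmulZr 0 x 0; rewrite !scale0r. Qed.

Lemma cmulNl x y : (- x) ** y = - (x ** y).
Proof. by rewrite -scaleN1r cmulZl scaleN1r. Qed.

Lemma cmulNr x y : x ** (- y) = - (x ** y).
Proof. by rewrite -scaleN1r cmulZr scaleN1r. Qed.

Lemma star0 : star 0 = 0 :> A.
Proof. by apply: nr_eq0; rewrite nr_star nr0. Qed.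

Lemma starN x : star (- x) = - star x.
Proof. by rewrite -scaleN1r starZ rmorphN1 scaleN1r. Qed.

Lemma closed_nr (D : set A) x : closed D ->
  (forall e, 0 < e -> exists2 d, D d & nr (x - d) <= e) -> D x.
Proof.
move=> cD xD; apply: cD => B /nbhs_ballP[[e e'] /=]; rewrite ltcE /= => /andP[/eqP -> e0] eB.
have [|d Dd xd] := xD (e / 2); first by rewrite divr_gt0.
exists d; split=> //; apply: eB; rewrite -ball_normE /= nrE ltcR.
by apply: le_lt_trans xd _; lra.
Qed.

Lemma geometric_small (r : R) : 0 <= r < 1 -> forall e, 0 < e -> exists n, r ^+ n <= e.
Proof.
move=> /andP[r0 r1] e e0; have : (fun n => r ^+ n) @ \oo --> 0.
  by apply: cvg_expr; rewrite ger0_norm.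
move=> /cvgrPdist_le /(_ e e0)[N _ /(_ N)]; rewrite /= leqnn => /(_ isT).
by rewrite sub0r normrN ger0_norm ?exprn_ge0 // => ?; exists N.
Qed.

Lemma geometric_cvg (r : R) (u : nat -> A) : 0 <= r < 1 ->
  (forall n m, nr (u (n + m)%N - u n) <= r ^+ n) ->
  exists y, forall n, nr (y - u n) <= r ^+ n.
Proof.
move=> r01 ur; have /andP[r0 r1] := r01.
have rn n m : (n <= m)%N -> nr (u m - u n) <= r ^+ n.
  by move=> /subnKC <-.
have : cvg (u @ \oo).
  apply: cauchy_cvg; apply/cauchy_ballP => -[e e']; rewrite ltcE /= => /andP[/eqP -> e0].
  have [|N Ne] := geometric_small r01 (e := e / 4); first by rewrite divr_gt0.
  exists ([set u n | n in [set n | (N <= n)%N]], [set u n | n in [set n | (N <= n)%N]]).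
    by split; exists N => // n Nn; exists n.
  move=> [_ _] /= [[n Nn <-] [m Nm <-]]; rewrite -ball_normE /= nrE ltcR.
  apply: le_lt_trans (nr_triangle (u N) _ _) _; rewrite [nr (u N - _)]nrB.
  by have := rn _ _ Nn; have := rn _ _ Nm; lra.
move=> /cvg_ex[y] uy; exists y => n; apply/ler_addgt0Pr => e e0.
have e0' : (0 : R[i]) < e%:C by rewrite ltcR.
move/cvgrPdist_le : uy => /(_ _ e0')[N _ /(_ (maxn N n))] /=.
rewrite leq_maxl nrE lecR => /(_ isT) ye.
apply: le_trans (nr_triangle (u (maxn N n)) _ _) _; rewrite addrC lerD //.
by apply: rn; rewrite leq_maxr.
Qed.

(* The element y is 1 - sqrt (1 - x^2); it is obtained as the fixed point of the
   contraction y |-> (x^2 + y^2) / 2, so that no unit is needed. *)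
Lemma one_minus_sqrt (D : set A) x : cstar_subalgebra D -> D x -> star x = x ->
  nr x < 1 -> exists y, [/\ D y, star y = y & x ** x = y + y - y ** y].
Proof.
move=> [cD D0 DL DM DS] Dx sx x1; set r := nr x in x1 *.
have r0 : 0 <= r by exact: nr_ge0.
have r01 : 0 <= r < 1 by rewrite r0.
pose h : R[i] := (2^-1)%:C.
have nh : normc h = 2^-1 by rewrite /= expr0n addr0 sqrtr_sqr ger0_norm // invr_ge0.
have hh z : h *: z + h *: z = z.
  by rewrite -scalerDl -rmorphD -[2^-1]mul1r -splitr rmorph1 scale1r.
pose u := fix u n := if n is n'.+1 then h *: (x ** x + u n' ** u n') else 0.
have uS n : u n.+1 = h *: (x ** x + u n ** u n) by [].
(* The ball of radius r is preserved because (r^2 + r^2) / 2 <= r for r < 1; on it the iteration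
   contracts by the factor r. *)
have u_le n : nr (u n) <= r.
  elim: n => [|n IH]; first by rewrite nr0.
  rewrite uS nrZ nh; have := nrD (x ** x) (u n ** u n).
  have := nrM x x; have := nrM (u n) (u n); have := nr_ge0 (u n); rewrite -/r.
  by nra.
have step n m : nr (u n.+1 - u m.+1) <= r * nr (u n - u m).
  (* The difference of two squares, arranged for elements that need not commute. *)
  have -> : u n.+1 - u m.+1 = h *: (u n ** (u n - u m) + (u n - u m) ** u m).
    rewrite !uS -scalerBr cmulDr cmulNr cmulDl cmulNl addrA subrK.
    by rewrite opprD addrACA subrr add0r.
  rewrite nrZ nh; have := nrD (u n ** (u n - u m)) ((u n - u m) ** u m).
  have := nrM (u n) (u n - u m); have := nrM (u n - u m) (u m).
  have := u_le n; have := u_le m; have := nr_ge0 (u n - u m).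
  by nra.
have [|y yu] := @geometric_cvg r u r01.
  elim=> [|n IH] m.
    by rewrite add0n subr0 expr0; exact: le_trans (u_le m) (ltW x1).
  by rewrite addSn exprS; apply: le_trans (step _ _) _; rewrite ler_wpM2l.
have small z C : (forall n, nr z <= C * r ^+ n) -> z = 0.
  move=> zC; apply/nr_eq0/eqP; rewrite eq_le nr_ge0 andbT.
  apply: (@le0_eps _ _ `|C|) => e /(geometric_small r01)[n ne].
  apply: le_trans (zC n) _; rewrite [e * _]mulrC.
  apply: le_trans (ler_wpM2r (exprn_ge0 n r0) (ler_norm C)) _.
  by rewrite ler_wpM2l.
have y1 : nr y <= 1 by have := yu 0%N; rewrite subr0 expr0.
have un1 n : nr (u n) <= 1 by exact: le_trans (u_le n) (ltW x1).
exists y; split.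
- apply: closed_nr => // e /(geometric_small r01)[n ne].
  exists (u n); last exact: le_trans (yu n) ne.
  elim: n {ne} => [//|n IH]; rewrite uS scalerDr -[h *: (u n ** u n)]addr0.
  by apply: (DL); [exact: DM|apply: DL => //; exact: DM].
- apply/subr0_eq/(small _ 2) => n; apply: le_trans (nr_triangle (u n) _ _) _.
  have su : star (u n) = u n.
    elim: n => [|n IH]; first exact: star0.
    by rewrite uS starZ starD !starM IH sx [Num.conj h]conjc_real.
  have -> : star y - u n = star (y - u n) by rewrite starD starN su.
  by rewrite nr_star [nr (u n - y)]nrB; have := yu n; lra.
(* Substituting 2 u_(n+1) = x^2 + u_n^2 leaves four errors, two from y^2 - u_n^2 and two from y -
   u_(n+1), each at most r^n. *)
- apply/subr0_eq/(small _ 4) => n.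
  have -> : x ** x - (y + y - y ** y) =
      (y ** (y - u n) + (y - u n) ** u n) - (y - u n.+1) - (y - u n.+1).
    have uu : u n.+1 + u n.+1 = x ** x + u n ** u n by rewrite uS hh.
    rewrite cmulDr cmulNr cmulDl cmulNl addrA subrK -[RHS]addrA -opprD addrACA -opprD.
    rewrite !opprB uu [x ** x + u n ** u n]addrC.
    rewrite -[u n ** u n + _ - _]addrA [RHS]addrA subrK.
    by rewrite addrCA.
  have := nrD (y ** (y - u n) + (y - u n) ** u n - (y - u n.+1)) (- (y - u n.+1)).
  have := nrD (y ** (y - u n) + (y - u n) ** u n) (- (y - u n.+1)).
  have := nrD (y ** (y - u n)) ((y - u n) ** u n).
  have := nrM y (y - u n); have := nrM (y - u n) (u n); rewrite nrN.
  have := un1 n; have := yu n; have := yu n.+1; have := nr_ge0 (y - u n).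
  have : r ^+ n.+1 <= r ^+ n by rewrite exprS ler_piMl ?exprn_ge0 // ltW.
  by nra.
Qed.

(* A character of the subalgebra D, given as a function on the ambient algebra
   whose values outside D are irrelevant. *)
Definition char_on (D : set A) (chi : A -> R[i]) : Prop :=
  [/\ forall c x y, D x -> D y -> chi (c *: x + y) = c * chi x + chi y,
      forall x y, D x -> D y -> chi (x ** y) = chi x * chi y
    & forall x, D x -> chi (star x) = conjc (chi x)].

Lemma normc_conj (c : R[i]) : conjc c * c = (normc c ^+ 2)%:C.
Proof.
case: c => a b; rewrite /= sqr_sqrtr ?addr_ge0 ?sqr_ge0 //.
by apply/eqP; rewrite eq_complex /=; apply/andP; split; apply/eqP; ring.
Qed.

(** Normalises an arbitrary x to a self-adjoint element to which [one_minus_sqrt] applies. *)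
Lemma scaled_cstar x (c : R) : nr x < c ->
  let w := ((c ^- 2)%:C : R[i]) *: (star x ** x) in star w = w /\ nr w < 1.
Proof.
move=> xc; have c0 : 0 < c by exact: le_lt_trans (nr_ge0 x) xc.
split; first by rewrite starZ starM starK [Num.conj _]conjc_real.
rewrite nrZ nr_cstar /= expr0n addr0 sqrtr_sqr normrV ?unitfE ?gt_eqF ?exprn_gt0 //.
rewrite ger0_norm ?exprn_ge0 ?ltW // -[c ^- 2]exprVn -exprMn exprn_ilt1 //.
  by rewrite mulr_ge0 ?nr_ge0 // invr_ge0 ltW.
by rewrite mulrC ltr_pdivrMr // mul1r.
Qed.

(** With w = x^* x / c^2 and the y of [one_minus_sqrt], b = chi(w) = |chi(x)|^2 / c^2 and a = chi(y)
    are real, and b^2 = 2 a - a^2 = 1 - (1 - a)^2 <= 1. Thus |chi(x)| <= c for every c above the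
    norm of x. *)
Lemma char_bounded (D : set A) chi x : cstar_subalgebra D -> char_on D chi -> D x ->
  normc (chi x) <= nr x.
Proof.
move=> sD [chiL chiM chiS] Dx; have [cD D0 DL DM DS] := sD.
have chi0 : chi 0 = 0.
  have := chiL 1 0 0 D0 D0; rewrite scaler0 addr0 mul1r => /eqP.
  by rewrite -[X in X == _]addr0 (inj_eq (addrI _)) eq_sym => /eqP.
have chiZ c y : D y -> chi (c *: y) = c * chi y.
  by move=> Dy; rewrite -[c *: y]addr0 chiL // chi0 addr0.
have chiD y z : D y -> D z -> chi (y + z) = chi y + chi z.
  by move=> Dy Dz; have := chiL 1 y z Dy Dz; rewrite scale1r mul1r.
have DZ c y : D y -> D (c *: y) by move=> Dy; rewrite -[c *: y]addr0; exact: DL.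
have DD y z : D y -> D z -> D (y + z) by move=> Dy; rewrite -[y]scale1r; exact: DL.
apply/ler_addgt0Pr => e e0; set c := nr x + e.
have c0 : 0 < c by rewrite ltr_wpDl // nr_ge0.
have [|sw w1] := @scaled_cstar x c; first by rewrite ltrDl.
set w := (_ *: _) in sw w1.
have Dw : D w by exact/DZ/DM/Dx/DS.
have [y [Dy sy wy]] := one_minus_sqrt sD Dw sw w1.
have DSx : D (star x) by exact: DS.
pose b := c ^- 2 * normc (chi x) ^+ 2.
have chiw : chi w = b%:C.
  by rewrite chiZ; [rewrite chiM // chiS // normc_conj /b [RHS]rmorphM|exact: DM].
have [a chiy] : exists a : R, chi y = a%:C.
  have := chiS y Dy; rewrite sy; case: (chi y) => a b' /= [bb]; exists a.
  by congr Complex; move: bb; lra.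
have b1 : b <= 1.
  have := chiM w w Dw Dw; rewrite wy -scaleN1r addrC chiL //; first last.
  - exact: DD.
  - exact: DM.
  rewrite chiM // chiD // chiw chiy => /(congr1 (@complex.Re R)) /=.
  rewrite !(mul0r, mulr0, subr0, oppr0) => h.
  by have := sqr_ge0 (1 - a); nra.
move: b1; rewrite /b mulrC ler_pdivrMr ?exprn_gt0 // mul1r.
by rewrite ler_pXn2r // nnegrE ?(ltW c0) //; case: (chi x) => ? ?; exact: sqrtr_ge0.
Qed.

Lemma subalgebraT : cstar_subalgebra [set: A].
Proof. by split=> //; exact: closedT. Qed.

(** The same device in operator form: |v|^2 - |h(w) v|^2 = |v - h(y) v|^2, so h(w) is contractive,
    and |h(x) v|^2 = c^2 <h(w) v, v>. *)
Lemma star_hom_bop_bounded (H : hilbert R) (h : A -> bop H) x v : star_hom h ->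
  nrm (h x v) <= nr x * nrm v.
Proof.
move=> [hL hM hS].
have h0 : h 0 = 0.
  have := hL 1 0 0; rewrite scaler0 addr0 scale1r => /eqP.
  by rewrite -[X in X == _]addr0 (inj_eq (addrI _)) eq_sym => /eqP.
have hZ c y : h (c *: y) = c *: h y by rewrite -[c *: y]addr0 hL h0 addr0.
have hD y z : h (y + z) = h y + h z by have := hL 1 y z; rewrite !scale1r.
apply/ler_addgt0Pr => e e0.
have [->|v0] := eqVneq v 0; first by rewrite op0 nrm0 mulr0 add0r ltW.
have {}v0 : 0 < nrm v.
  by rewrite lt_def nrm_ge0 andbT; apply: contra v0 => /eqP/nrm_eq0 ->.
(* Chosen so that [c * nrm v] is exactly the target bound plus e. *)
set c := nr x + e / nrm v.
have c0 : 0 < c by rewrite ltr_wpDl ?nr_ge0 // divr_gt0.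
have [|sw w1] := @scaled_cstar x c; first by rewrite ltrDl divr_gt0.
set w := (_ *: _) in sw w1.
have [y [_ sy wy]] := one_minus_sqrt subalgebraT I sw w1.
have hw : nrm (h w v) <= nrm v.
  rewrite nrm_le ?nrm_ge0 // nrm_sq op_adj.
  have adjw u : adj (h w) u = h w u by rewrite -[in RHS]sw hS.
  have -> : adj (h w) (h w v) = h (w ** w) v by rewrite adjw hM.
  have -> : w ** w = (-1) *: (y ** y) + (y + y) by rewrite wy scaleN1r addrC.
  have yadj : adj (h y) v = h y v by rewrite -[in RHS]sy hS.
  rewrite hL hD hM scaleN1r !bopDE bopNE bopME !(ipDr, ipNr).
  rewrite [ip v (h y (h y v))]ipC op_adj yadj [ip v _]ipC.
  have := ip_ge0 (v - h y v); rewrite !(ipDl, ipDr, ipNl, ipNr).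
  by rewrite [ip v (h y v)]ipC; lra.
have hx : nrm (h x v) ^+ 2 = c ^+ 2 * ip (h w v) v.
  rewrite nrm_sq op_adj.
  have -> : adj (h x) (h x v) = h (star x ** x) v by rewrite hM hS.
  have -> : star x ** x = ((c ^+ 2)%:C : R[i]) *: w.
    by rewrite scalerA -rmorphM divff ?scale1r // gt_eqF // exprn_gt0.
  by rewrite hZ bopZE /cscale /= scale0r addr0 ipZr ipC.
have : nrm (h x v) <= c * nrm v.
  rewrite -(@ler_pXn2r _ 2) ?nnegrE ?nrm_ge0 ?mulr_ge0 ?nrm_ge0 ?(ltW c0) //.
  rewrite hx exprMn ler_wpM2l ?sqr_ge0 //; apply: le_trans (cauchy_schwarz _ _) _.
  by rewrite expr2 ler_wpM2r ?nrm_ge0.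
by rewrite /c mulrDl divfK ?gt_eqF.
Qed.

End CStarNorm.

(** * The representation on tight filters *)

Section TightRepresentation.
Variables (R : realType) (L : labelledSpace).
Hypotheses (wlr : weakly_left_resolving L) (relc : closed_rel_complements L).
Local Notation T := (set_type (@tight_filters L)).
Implicit Types (xi eta : T) (a b : alphabet L) (X Y : set (vertex L)).
Local Open Scope cstar_scope.

Lemma tightP xi : tight_filters (val xi).
Proof. exact: set_mem (valP xi). Qed.

Definition mk_tight (F : set (preidem L)) (tF : tight_filters F) : T := SigSub (mem_set tF).

Lemma mem_mk_idem xi w X : val xi (mk_idem w X) <-> val xi (Some (w, X)).
Proof.
have [[xiE _ xi0 _ _] _] := tightP xi; rewrite /mk_idem; case: asboolP => // X0.
by split=> // /xiE[].
Qed.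

Definition shift_fwd a xi : option T :=
  if pselect (val xi (dom_idem a)) is left h
  then Some (mk_tight (tight_cons wlr relc (tightP xi) h)) else None.

Definition shift_bwd a eta : option T :=
  if pselect (val eta (ran_idem a)) is left h
  then Some (mk_tight (tight_behead wlr relc (tightP eta) h)) else None.

Lemma shift_fwdP a xi eta : shift_fwd a xi = Some eta <->
  val xi (dom_idem a) /\ val eta = cons_filter a (val xi).
Proof.
rewrite /shift_fwd; case: pselect => [xia|nxia]; last by split=> // -[].
by split=> [[<-]//|[_ e]]; congr Some; apply: val_inj.
Qed.

Lemma shift_bwdP a xi eta : shift_bwd a eta = Some xi <->
  val eta (ran_idem a) /\ val xi = behead_filter a (val eta).
Proof.
rewrite /shift_bwd; case: pselect => [xia|nxia]; last by split=> // -[].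
by split=> [[<-]//|[_ e]]; congr Some; apply: val_inj.
Qed.

Lemma shiftP a xi eta : shift_fwd a xi = Some eta <-> shift_bwd a eta = Some xi.
Proof.
rewrite shift_fwdP shift_bwdP; split=> -[xia e].
  split; first by rewrite e; apply/(cons_filter_ran relc _ (tightP xi)).
  by rewrite e (cons_filterK wlr relc (tightP xi)).
split; first by rewrite e; apply/(behead_filter_dom relc).
by rewrite e (behead_filterK wlr relc (tightP eta)).
Qed.

Definition shift_pinj a : pinj T := Pinj (shiftP a).

Definition tight_mem (x : preidem L) : set T := [set xi | val xi x].

Definition rep_p X : bop (cl2 R T) := pid R (tight_mem (Some ([::], X))).
Definition rep_s a : bop (cl2 R T) := ptr R (shift_pinj a).

Lemma shift_mem a xi eta w X : lsets_below (a :: w) X ->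
  shift_fwd a xi = Some eta -> val eta (Some (a :: w, X)) <-> val xi (Some (w, X)).
Proof.
move=> Xaw /shiftP/shift_bwdP[_ ->].
by rewrite (behead_filterP (tightP eta)).
Qed.

Lemma shift_mem_nil a xi eta X : lsets L X ->
  shift_fwd a xi = Some eta ->
  val eta (Some ([::], X)) <-> val xi (Some ([::], rrange X [:: a])).
Proof.
move=> LX /shift_fwdP[_ ->]; split=> [[_ /mem_mk_idem]//|xiX].
have [[xiE _ _ _ _] _] := tightP xi; split; last exact/mem_mk_idem.
apply/idemP; split=> //; have [_ _ [v]] := xiE _ xiX.
by case/rrange_pointwise => x Xx _; exists x.
Qed.

(** A tight filter contains (a w, X, a w) exactly when it is a xi with (w, X, w) in xi. If no letter
    a can be removed, upward closure excludes (a w, X, a w), as it lies below [ran_idem a]. *)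
Lemma rep_s_conj a w X : lsets_below (a :: w) X ->
  rep_s a ** pid R (tight_mem (Some (w, X))) ** star (rep_s a) =
  pid R (tight_mem (Some (a :: w, X))).
Proof.
move=> Xaw; rewrite /rep_s /pid ptr_star !ptr_mul; apply: ptr_ext => eta /=.
case ebwd : (shift_bwd a eta) => [xi|] /=; last first.
  rewrite restrict_out // => etaX.
  suff : val eta (ran_idem a).
    by move: ebwd; rewrite /shift_bwd; case: pselect.
  have [fe _] := tightP eta; have [etaE _ _ _ _] := fe.
  apply: (filter_up wlr relc fe etaX); first exact: (idem_ran relc).
  have [_ [_ Xw] _] := etaE _ etaX.
  move=> q /cylP[u qu Xu]; apply/cylP; exists (w ++ u) => //.
  by rewrite -wrange_cat; exact: (rrange_below Xw Xu).
have efwd := iffRL (shiftP _ _ _) ebwd; have etaX := shift_mem Xaw efwd.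
have [xiX|nxiX] := pselect (val xi (Some (w, X))).
  by rewrite !restrict_in //=; exact/etaX.
by rewrite !restrict_out // => /etaX.
Qed.

(** Each relation becomes a fact about tight filters: (i) is closure under meets together with
    [tight_setU], (ii) is [shift_mem_nil], orthogonality in (iii) is [cons_filter_ran], and (iv) is
    [tight_regular]. *)
Lemma tight_representation : representation rep_p rep_s.
Proof.
have fxi xi : is_filter (@idem L) None (@idem_mul L) (val xi) by case: (tightP xi).
have xiE xi x : val xi x -> idem x by case: (fxi xi) => h _ _ _ _; exact: h.
have pE X xi : tight_mem (Some ([::], X)) xi = val xi (Some ([::], X)) by [].
have memI X Y xi : lsets L X -> lsets L Y ->
    val xi (Some ([::], X `&` Y)) <-> val xi (Some ([::], X)) /\ val xi (Some ([::], Y)).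
  move=> LX LY; rewrite -mem_mk_idem; split=> [xiI|[xiX xiY]].
    have [_ _ [v [Xv Yv]]] := xiE _ _ ((mem_mk_idem _ _ _).1 xiI).
    by apply/(filterM wlr relc (fxi xi)) => //; apply/idemP; split=> //; exists v.
  exact: (filterM wlr relc (fxi xi) (xiE _ _ xiX) (xiE _ _ xiY)).2.
split.
- split=> [X LX|a].
    by split; [exact: pid_star|rewrite /rep_p -pidI setIid].
  rewrite /partial_isometry /rep_s ptr_star !ptr_mul; apply: ptr_ext => eta /=.
  case ebwd : (shift_bwd a eta) => [xi|] //=.
  by move/shiftP: (ebwd) => -> /=.
- split=> [X Y LX LY|X Y LX LY|].
  + rewrite /rep_p -pidI; congr (pid _ _); apply/seteqP; split=> xi /=.
      by move/(memI _ _ _ LX LY).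
    by move/(memI _ _ _ LX LY).
  + rewrite /rep_p (_ : tight_mem (Some ([::], X `|` Y)) =
        tight_mem (Some ([::], X)) `|` tight_mem (Some ([::], Y))); last first.
      by apply/seteqP; split=> xi; move/(tight_setU wlr relc (tightP xi) LX LY).
    rewrite pidU; congr (_ - _); congr (pid _ _); apply/seteqP; split=> xi /=.
      by move/(memI _ _ _ LX LY).
    by move/(memI _ _ _ LX LY).
  + rewrite /rep_p -(pid0 R T); congr (pid _ _); apply/seteqP; split=> // xi /=.
    by move=> /xiE[_ _ []].
- move=> X a LX; rewrite /rep_p /rep_s /pid !ptr_mul; apply: ptr_ext => eta /=.
  case ebwd : (shift_bwd a eta) => [xi|] /=; last first.
    by rewrite /restrict; case: asboolP => //= _; rewrite ebwd.
  have := shift_mem_nil LX (iffRL (shiftP _ _ _) ebwd) => etaX.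
  have [xiX|nxiX] := pselect (val xi (Some ([::], rrange X [:: a]))).
    by rewrite !restrict_in //=; exact/etaX.
  by rewrite !restrict_out //= => /etaX.
- split=> [a|a b ba].
    rewrite /rep_p /rep_s /pid ptr_star !ptr_mul; apply: ptr_ext => xi /=.
    case efwd : (shift_fwd a xi) => [eta|] /=.
      have /shift_fwdP[xia _] := efwd; move/shiftP: efwd => ->.
      by rewrite restrict_in.
    rewrite restrict_out // => xia; move: efwd; rewrite /shift_fwd.
    by case: pselect.
  rewrite /rep_s ptr_star ptr_mul; apply: ptr_eq0 => xi /=.
  case efwd : (shift_fwd b xi) => [eta|] //=.
  case ebwd : (shift_bwd a eta) => [xi'|] //.
  have /shift_bwdP[etaa _] := ebwd; have /shift_fwdP[_ etaE] := efwd.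
  move: etaa; rewrite etaE => /(cons_filter_ran relc _ (tightP xi))[ba' _].
  by rewrite ba' eqxx in ba.
- move=> X LX X0 finX nsink.
  have -> : rep_p X = pid R (\bigcup_(a in out_labels X)
      tight_mem (Some ([:: a], rrange X [:: a]))).
    congr (pid _ _); apply/seteqP; split=> xi.
      by move/(tight_regular wlr relc (tightP xi) LX (And3 X0 finX nsink)) => -[a]; exists a.
    move=> [a Xa xia]; apply/(tight_regular wlr relc (tightP xi) LX (And3 X0 finX nsink)).
    by exists a.
  rewrite pid_bigcup //.
    apply: eq_fsbigr => a _; rewrite rep_s_conj //.
    by split; [exact: lsets_rrange|exact: rrange_wrange].
  (* Idempotents over distinct letters have product zero, so no filter contains both. *)
  move=> a b _ _ [xi [xia xib]]; apply: contrapT => ab.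
  have [_ _ xi0 _ _] := fxi xi; apply: xi0.
  have := (filterM wlr relc (fxi xi) (xiE _ _ xia) (xiE _ _ xib)).2 (conj xia xib).
  by rewrite /idem_mul /= [b == a]eq_sym; case: eqP => // ->.
Qed.

End TightRepresentation.

(** * Characters of the diagonal *)

Section Sandwiches.
Variables (R : realType) (L : labelledSpace).
Hypotheses (wlr : weakly_left_resolving L) (relc : closed_rel_complements L).
Variables (A : cstarAlgType R) (p : set (vertex L) -> A) (s : alphabet L -> A).
Hypothesis rep : representation p s.
Implicit Types (a b : alphabet L) (u w : seq (alphabet L)) (X Y : set (vertex L)).
Local Open Scope cstar_scope.

Local Arguments sandwich : simpl never.

Lemma foldl_cmul (z1 z2 : A) w :
  foldl (fun z b => z ** s b) (z1 ** z2) w = z1 ** foldl (fun z b => z ** s b) z2 w.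
Proof. by elim: w z2 => //= b w IH z2; rewrite -cmulA IH. Qed.

Lemma sandwich_cons a w X :
  sandwich p s (a :: w) X = s a ** sandwich p s w X ** star (s a).
Proof. by case: w => [//|b w]; rewrite /sandwich /= foldl_cmul starM !cmulA. Qed.

(** The nested form of the sandwich, with an arbitrary inner element: additivity and relation (iv)
    can be applied inside, and a letter added at the end of the word. *)
Definition conj_word w (z : A) : A := foldr (fun a y => s a ** y ** star (s a)) z w.

Lemma sandwichE w X : sandwich p s w X = conj_word w (p X).
Proof. by elim: w => [//|a w IH]; rewrite sandwich_cons IH. Qed.

Lemma conj_word_rcons w a z : conj_word (rcons w a) z = conj_word w (s a ** z ** star (s a)).
Proof. by rewrite /conj_word foldr_rcons. Qed.

Lemma conj_wordD w y z : conj_word w (y + z) = conj_word w y + conj_word w z.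
Proof. by elim: w => //= a w ->; rewrite cmulDr cmulDl. Qed.

Lemma conj_word0 w : conj_word w 0 = 0.
Proof. by elim: w => //= a w ->; rewrite cmul0r cmul0l. Qed.

Lemma sandwich_set0 w : sandwich p s w set0 = 0.
Proof. by case: rep => _ [_ _ p0] _ _ _; rewrite sandwichE p0 conj_word0. Qed.

Lemma star_sandwich w X : lsets L X -> star (sandwich p s w X) = sandwich p s w X.
Proof.
case: rep => [[pP _] _ _ _ _] LX; elim: w => [|a w IH]; first by case: (pP X LX).
by rewrite sandwich_cons !starM starK IH cmulA.
Qed.

(** Relation (ii) moves p_X past the letters one at a time, replacing X by its range at each
    letter. *)
Lemma p_sandwich X w Y : lsets L X -> lsets L Y ->
  p X ** sandwich p s w Y = sandwich p s w (rrange X w `&` Y).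
Proof.
case: rep => [_ [pI _ _] ps _ _] + LY.
elim: w X => [|a w IH] X LX; first exact: esym (pI X Y LX LY).
rewrite !sandwich_cons rrange_cons -IH; last exact: lsets_rrange.
by rewrite !cmulA ps.
Qed.

Definition idem_val (x : preidem L) : A :=
  if x is Some (w, X) then sandwich p s w X else 0.

Lemma idem_val_mk w X : idem_val (mk_idem w X) = sandwich p s w X.
Proof.
rewrite /mk_idem; case: asboolP => // /set0P/negP/negPn/eqP ->.
by rewrite sandwich_set0.
Qed.

(** Induction on both words. Equal first letters leave s_a^* s_a = p_(r(a)) in the middle, which is
    absorbed because Y lies in r(a w); distinct ones give zero. *)
Lemma sandwichM u X w Y : lsets_below u X -> lsets_below w Y ->
  sandwich p s u X ** sandwich p s w Y = idem_val (idem_mul (Some (u, X)) (Some (w, Y))).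
Proof.
have [_ _ _ [ss sb] _] := rep.
elim: u w => [|a u IH] [|b w] [LX Xu] [LY Yw].
- by rewrite /idem_mul /= idem_val_mk; exact: p_sandwich.
- by rewrite /idem_mul /= idem_val_mk; exact: p_sandwich.
(* Taking adjoints exchanges the factors and reduces this case to [p_sandwich]. *)
- rewrite /idem_mul /= idem_val_mk -[LHS]starK starM !star_sandwich //.
  rewrite [sandwich p s [::] Y ** _]p_sandwich // star_sandwich 1?setIC //.
  by apply: lsetsI => //; exact: lsets_rrange.
rewrite !sandwich_cons.
have -> : s a ** sandwich p s u X ** star (s a) ** (s b ** sandwich p s w Y ** star (s b)) =
    s a ** sandwich p s u X ** (star (s a) ** s b) ** sandwich p s w Y ** star (s b).
  by rewrite !cmulA.
have [ab|ab] := eqVneq b a; last first.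
  by rewrite sb ?cmul0r ?cmul0l // /idem_mul /= [a == b]eq_sym (negbTE ab).
rewrite ab ss in Yw *.
have -> : s a ** sandwich p s u X ** p (wrange [:: a]) ** sandwich p s w Y ** star (s a) =
    s a ** (sandwich p s u X ** (p (wrange [:: a]) ** sandwich p s w Y)) ** star (s a).
  by rewrite !cmulA.
rewrite p_sandwich //; last exact: lsets_wrange.
rewrite -wrange_cat setIC (setIidl Yw) IH; last 2 first.
- by split=> //; exact: subset_trans Xu (@wrange_cons _ _ _).
- by split=> //; exact: subset_trans Yw (@wrange_cons _ _ _).
rewrite /idem_mul /= eqxx /=; case: ifP => _; first by rewrite !idem_val_mk sandwich_cons.
by case: ifP => _; rewrite ?idem_val_mk ?sandwich_cons //= cmul0r cmul0l.
Qed.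

Lemma idem_valM x y : idem x -> idem y ->
  idem_val x ** idem_val y = idem_val (idem_mul x y).
Proof.
case: x y => [[u X]|] [[w Y]|] /= Ex Ey; rewrite ?cmul0l ?cmul0r //.
  by case: Ex Ey => _ Xu _ [_ Yw _]; exact: sandwichM.
Qed.

Lemma star_idem_val x : idem x -> star (idem_val x) = idem_val x.
Proof. by case: x => [[w X] [_ [LX _] _]|_]; [exact: star_sandwich|exact: star0]. Qed.

Lemma sandwich_split w X Y : lsets L X -> lsets L Y ->
  sandwich p s w X = sandwich p s w (X `&` Y) + sandwich p s w (X `\` Y).
Proof.
move=> LX LY; case: rep => _ [_ pU p0] _ _ _.
rewrite !sandwichE -conj_wordD; congr conj_word.
have := pU (X `&` Y) (X `\` Y) (lsetsI LX LY) (relc LX LY).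
have -> : (X `&` Y) `&` (X `\` Y) = set0.
  by apply/seteqP; split=> // v [[_ Yv] [_ /(_ Yv)]].
rewrite p0 subr0 => <-; congr p.
by apply/seteqP; split=> v; [move=> Xv; have [|] := pselect (Y v); [left|right]|case=> -[]].
Qed.

Lemma sandwich_regular w X : lsets L X -> regular X ->
  sandwich p s w X =
  \sum_(a <- fset_set (out_labels X)) sandwich p s (rcons w a) (rrange X [:: a]).
Proof.
move=> LX [X0 finX nsink]; case: rep => _ _ _ _ preg.
rewrite sandwichE (preg X LX X0 finX nsink) fsbig_finite //.
rewrite (big_morph (conj_word w) (conj_wordD w) (conj_word0 w)).
by apply: eq_bigr => a _; rewrite sandwichE conj_word_rcons.
Qed.

End Sandwiches.

(** * Characters of a generated C*-subalgebra *)

Section Characters.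
Variables (R : realType) (A : cstarAlgType R).
Implicit Types (D G : set A) (x y z d : A).
Local Open Scope cstar_scope.

Lemma cstar_generated_subalgebra G : cstar_subalgebra (cstar_generated G).
Proof.
split.
- by apply: closed_bigI => B [[]].
- by move=> B [[]].
- by move=> c x y Dx Dy B [sB GB]; have [_ _ h _ _] := sB; apply: h; [exact: Dx|exact: Dy].
- by move=> x y Dx Dy B [sB GB]; have [_ _ _ h _] := sB; apply: h; [exact: Dx|exact: Dy].
- by move=> x Dx B [sB GB]; have [_ _ _ _ h] := sB; apply: h; exact: Dx.
Qed.

Lemma closed_of_nr D :
  (forall x, (forall e, 0 < e -> exists2 d, D d & nr (x - d) <= e) -> D x) -> closed D.
Proof.
move=> Dcl x xD; apply: Dcl => e e0.
have e0' : (0 : R[i]) < e%:C by rewrite ltcR.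
have [d [Dd]] := xD _ (nbhsx_ballx x _ e0').
by rewrite -ball_normE /= nrE ltcR => /ltW; exists d.
Qed.

Lemma char_onB D chi x y : cstar_subalgebra D -> char_on D chi -> D x -> D y ->
  chi (x - y) = chi x - chi y.
Proof.
move=> [_ D0 _ _ _] [chiL _ _] Dx Dy.
by rewrite -scaleN1r addrC chiL // mulN1r addrC.
Qed.

Lemma char_on0 D chi : cstar_subalgebra D -> char_on D chi -> chi 0 = 0.
Proof.
move=> sD cchi; have [_ D0 _ _ _] := sD.
by rewrite -(subrr (0 : A)) (char_onB sD cchi) // subrr.
Qed.

Lemma normc_triangle (c d e : R[i]) : normc (c - e) <= normc (c - d) + normc (d - e).
Proof.
rewrite -lecR rmorphD /= -[X in X <= _]/`|c - e| -[X in _ <= X + _]/`|c - d|.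
by rewrite -[X in _ <= _ + X]/`|d - e|; apply: le_trans (ler_normD _ _); rewrite addrA subrK.
Qed.

(** The elements on which the characters agree form a C*-subalgebra; contractivity makes it closed.
    Membership in the generated algebra is carried along because [char_on] speaks only of its
    elements. *)
Lemma char_generated_eq G chi1 chi2 :
  char_on (cstar_generated G) chi1 -> char_on (cstar_generated G) chi2 ->
  (forall x, G x -> chi1 x = chi2 x) ->
  forall x, cstar_generated G x -> chi1 x = chi2 x.
Proof.
set D := cstar_generated G => c1 c2 c12.
have sD : cstar_subalgebra D by exact: cstar_generated_subalgebra.
have [cD D0 DL DM DS] := sD.
suff h : D `<=` [set x | D x /\ chi1 x = chi2 x] by move=> x /h[].
apply: smallest_sub; last by move=> x Gx; split; [move=> B [_]; exact|exact: c12].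
have [L1 M1 S1] := c1; have [L2 M2 S2] := c2.
split=> [||c x y [Dx ex] [Dy ey]|x y [Dx ex] [Dy ey]|x [Dx ex]].
- apply: closed_of_nr => x xD.
  have Dx : D x by apply: closed_nr => // e /xD[d [Dd _] xd]; exists d.
  split=> //; apply/subr0_eq/eq0_normc/eqP; rewrite eq_le.
  rewrite [0 <= _]normc_ge0 andbT; apply: (@le0_eps _ _ 2) => e /xD[d [Dd ed] xd].
  apply: le_trans (normc_triangle _ (chi1 d) _) _.
  rewrite {2}ed -(char_onB sD c1) // -(char_onB sD c2) //.
  have Dxd : D (x - d) by rewrite -scaleN1r addrC; exact: DL.
  have Ddx : D (d - x) by rewrite -scaleN1r addrC; exact: DL.
  have := char_bounded sD c1 Dxd; have := char_bounded sD c2 Ddx.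
  by rewrite (nrB d x); lra.
- by split=> //; rewrite (char_on0 sD c1) (char_on0 sD c2).
- by split; [exact: DL|rewrite L1 // L2 // ex ey].
- by split; [exact: DM|rewrite M1 // M2 // ex ey].
- by split; [exact: DS|rewrite S1 // S2 // ex].
Qed.

(** Comparison with the zero functional shows that a character vanishing on the generators vanishes
    on the whole subalgebra. *)
Lemma char_on_zero D : char_on D (fun => 0).
Proof. by split=> *; rewrite ?mulr0 ?addr0 // conjc0. Qed.

Lemma char_on_sum D chi (I : eqType) (r : seq I) (F : I -> A) :
  cstar_subalgebra D -> char_on D chi ->
  (forall i, i \in r -> D (F i) /\ chi (F i) = 0) -> chi (\sum_(i <- r) F i) = 0.
Proof.
move=> sD cchi rF; have [_ D0 DL _ _] := sD; have [chiL _ _] := cchi.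
suff [//] : D (\sum_(i <- r) F i) /\ chi (\sum_(i <- r) F i) = 0.
rewrite big_seq; apply: (big_ind (fun z => D z /\ chi z = 0)) => //.
  by split=> //; exact: char_on0 sD cchi.
move=> x y [Dx x0] [Dy y0]; rewrite -[x]scale1r; split; first exact: DL.
by rewrite chiL // x0 y0 mulr0 addr0.
Qed.

End Characters.

(** * The filter of a character *)

Section DiagonalCharacters.
Variables (R : realType) (L : labelledSpace).
Hypotheses (wlr : weakly_left_resolving L) (relc : closed_rel_complements L).
Variables (A : cstarAlgType R) (p : set (vertex L) -> A) (s : alphabet L -> A).
Hypothesis rep : representation p s.
Local Open Scope cstar_scope.
Local Notation D := (diagonal_algebra p s).
Local Notation ev := (idem_val p s).

Lemma diagonal_subalgebra : cstar_subalgebra D.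
Proof. exact: cstar_generated_subalgebra. Qed.

Lemma idem_val_diagonal x : idem x -> D (ev x).
Proof.
have [_ D0 _ _ _] := diagonal_subalgebra.
case: x => [[w X]|_]; last exact: D0.
by case=> lw Xw _ B [_]; apply; exists w, X.
Qed.

Section FilterOfCharacter.
Variable chi : A -> R[i].
Hypothesis cchi : char_on D chi.

Definition char_filter : set (preidem L) := [set x | idem x /\ chi (ev x) = 1].

Let sD := diagonal_subalgebra.

Lemma char_idem_valM x y : idem x -> idem y ->
  chi (ev (idem_mul x y)) = chi (ev x) * chi (ev y).
Proof.
move=> Ex Ey; case: cchi => _ chiM _.
by rewrite -(idem_valM relc rep) // chiM //; exact: idem_val_diagonal.
Qed.

Lemma char_idem_val01 x : idem x -> chi (ev x) <> 0 -> chi (ev x) = 1.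
Proof.
move=> Ex x0; have := char_idem_valM Ex Ex.
have -> : idem_mul x x = x by apply/(meet_leP wlr relc Ex Ex).
move=> h; apply: (mulfI (introN eqP x0)); rewrite mulr1; exact: esym.
Qed.

Lemma char_sandwich w X : chi (sandwich p s w X) <> 0 -> lsets_below w X ->
  char_filter (Some (w, X)).
Proof.
move=> wX0 Xw; have X0 : X !=set0.
  apply/set0P/eqP => X0; apply: wX0.
  by rewrite X0 (sandwich_set0 rep) (char_on0 sD cchi).
have EX : idem (Some (w, X)) by exact/idemP.
by split=> //; exact: (char_idem_val01 EX).
Qed.

(** The filter is non-empty since a character that vanishes on all generators is zero. Primeness and
    descent come from [sandwich_split] and [sandwich_regular]: the value 1 is a sum of values of
    parts, so they cannot all vanish, and a value that is not 0 is 1. *)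
Lemma char_filter_tight : (exists2 x, D x & chi x <> 0) -> tight_filters char_filter.
Proof.
move=> [x0 Dx0 chix0].
have chi0 := char_on0 sD cchi.
have ffilter : is_filter (@idem L) None (@idem_mul L) char_filter.
  split.
  - by move=> x [].
  - apply: contrapT => nne; apply: chix0.
    apply: (char_generated_eq cchi (char_on_zero _)) Dx0 => _ [w [X [lw Xw ->]]].
    apply: contrapT => wX0; apply: nne; exists (Some (w, X)).
    exact: char_sandwich.
  - by move=> [_]; rewrite /= chi0 => /eqP; rewrite eq_sym oner_eq0.
  - move=> x y [Ex x1] Ey xy; split=> //.
    by have := char_idem_valM Ex Ey; rewrite xy x1 mul1r.
  - move=> x y [Ex x1] [Ey y1]; split; first exact: idemM.
    by rewrite char_idem_valM // x1 y1 mulr1.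
apply: tight_of_prime_regular => //.
  move=> w X Y LY [[lw [LX Xw] X0] wX].
  have XIw : lsets_below w (X `&` Y) by split; [exact: lsetsI|move=> v [/Xw]].
  have XDw : lsets_below w (X `\` Y) by split; [exact: relc|move=> v [/Xw]].
  have h Z : lsets_below w Z -> chi (sandwich p s w Z) <> 0 -> char_filter (mk_idem w Z).
    move=> Zw wZ; have FZ := char_sandwich wZ Zw.
    by rewrite mk_idem_some //; case: FZ => /idemP[].
  have [I0|/eqP I0] := eqVneq (chi (sandwich p s w (X `&` Y))) 0; last by left; exact: h.
  right; apply: h => // D0; move: wX; rewrite /= (sandwich_split relc rep w LX LY).
  rewrite -[sandwich p s w (X `&` Y)]scale1r; case: cchi => chiL _ _.
  have DS Z : lsets_below w Z -> D (sandwich p s w Z) by move=> Zw B [_]; apply; exists w, Z.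
  rewrite chiL; [|exact: DS..].
  by rewrite I0 D0 mulr0 addr0 => /eqP; rewrite eq_sym oner_eq0.
move=> w X [[lw [LX Xw] X0] /= wX] regX; apply: contrapT => nex.
have [_ finX _] := regX.
move: wX; rewrite (sandwich_regular rep w LX regX) (char_on_sum sD cchi) //.
  by move=> /eqP; rewrite eq_sym oner_eq0.
move=> a; rewrite in_fset_set // => /set_mem Xa.
have below : lsets_below (rcons w a) (rrange X [:: a]).
  by split; [exact: lsets_rrange|rewrite -cats1; exact: rrange_below].
have EXa : idem (Some (rcons w a, rrange X [:: a])).
  by apply/idemP; split=> //; exact/rrange1_out_labels.
split; first exact: (idem_val_diagonal EXa).
by apply: contrapT => wa0; apply: nex; exists a => //; exact: char_sandwich.
Qed.

End FilterOfCharacter.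

End DiagonalCharacters.

Lemma initial_topology_continuous (S : choiceType) (T Y : topologicalType)
    (g : S -> T) (f : Y -> initial_topology g) :
  continuous (g \o f : Y -> T) -> continuous f.
Proof. by move=> /continuousP gf; apply/continuousP => _ [U oU <-]; exact: gf. Qed.

Lemma ptws_continuous (I : Type) (V Y : topologicalType) (f : Y -> {ptws I -> V}) :
  (forall i, continuous (fun y => f y i)) -> continuous f.
Proof.
move=> fi y; apply/cvg_sup => i; apply: initial_topology_continuous; exact: fi.
Qed.

Lemma continuous_normcP (R : realType) (Y : topologicalType) (f : Y -> R[i]^o) :
  continuous f <-> forall y e, 0 < e -> nbhs y [set z | normc (f y - f z) <= e].
Proof.
split=> [fc y e e0|fc y].
  have e0' : (0 : R[i]) < e%:C by rewrite ltcR.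
  have /cvgrPdist_le /(_ _ e0') := fc y; apply: filterS => z.
  by rewrite -[leLHS]/((normc (f y - f z))%:C) lecR.
apply/cvgrPdist_le => -[e e']; rewrite ltcE /= => /andP[/eqP -> e0].
apply: filterS (fc y e e0) => z /= fyz.
by rewrite -[leLHS]/((normc (f y - f z))%:C) lecR.
Qed.

Lemma continuous_linear_comb (R : realType) (Y : topologicalType) (c : R[i])
    (f g : Y -> R[i]^o) :
  continuous f -> continuous g -> continuous (fun y => c * f y + g y : R[i]^o).
Proof. by move=> fc gc y; apply: cvgD; [apply: cvgZl_tmp; exact: fc|exact: gc]. Qed.

Lemma continuous_mul (R : realType) (Y : topologicalType) (f g : Y -> R[i]^o) :
  continuous f -> continuous g -> continuous (fun y => f y * g y : R[i]^o).
Proof. by move=> fc gc y; apply: (@cvgM R[i]); [exact: fc|exact: gc]. Qed.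

(** * Vector states on the diagonal *)

Section DiagonalStates.
Variables (R : realType) (L : labelledSpace).
Hypotheses (wlr : weakly_left_resolving L) (relc : closed_rel_complements L).
Variables (A : cstarAlgType R) (p : set (vertex L) -> A) (s : alphabet L -> A).
Hypothesis rep : representation p s.
Local Notation T := (set_type (@tight_filters L)).
Variable h : A -> bop (cl2 R T).
Hypotheses (h_hom : star_hom h)
  (hp : forall X, lsets L X -> h (p X) = rep_p R X)
  (hs : forall a, h (s a) = rep_s R wlr relc a).
Implicit Types (xi eta : T) (x y d : A).
Local Open Scope cstar_scope.
Local Notation D := (diagonal_algebra p s).
Local Notation ev := (idem_val p s).

Lemma hom_sandwich w X : lsets_below w X ->
  h (sandwich p s w X) = pid R (tight_mem (Some (w, X))).
Proof.
have [_ hM hS] := h_hom.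
elim: w => [|a w IH] [LX Xw]; first exact: hp.
rewrite sandwich_cons !hM hS hs IH; first exact: rep_s_conj.
by split=> //; exact: subset_trans Xw (@wrange_cons _ _ _).
Qed.

Lemma hom_idem_val_delta (x : preidem L) xi : idem x ->
  h (ev x) (cdelta R xi) = cscale (if `[< val xi x >] then 1 else 0) (cdelta R xi).
Proof.
have [hL _ _] := h_hom.
have cs0 (v : cl2 R T) : cscale 0 v = 0 by rewrite /cscale !scale0r addr0.
have h0 : h 0 = 0.
  have := hL (-1) 0 0; rewrite !scaleN1r oppr0 addr0 => ->.
  by rewrite addNr.
case: x => [[w X] [_ Xw _]|_].
  rewrite /= hom_sandwich //; case: asboolP => xiX.
    by rewrite cscale1; apply: ptr_delta; exact: restrict_in.
  by rewrite cs0; apply: ptr_delta0; exact: restrict_out.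
have [[_ _ xi0 _ _] _] := tightP xi.
by rewrite asboolF // h0 cs0.
Qed.

Definition vec_state xi x : R[i] := cip (h x (cdelta R xi)) (cdelta R xi).

Lemma vec_state_eigen xi x c : h x (cdelta R xi) = cscale c (cdelta R xi) ->
  vec_state xi x = c.
Proof. by rewrite /vec_state => ->; rewrite cip_cscale cip_delta mulr1. Qed.

Lemma vec_stateL xi c x y : vec_state xi (c *: x + y) = c * vec_state xi x + vec_state xi y.
Proof.
have [hL _ _] := h_hom; by rewrite /vec_state hL bopDE bopZE cipDl cip_cscale.
Qed.

Lemma vec_stateB xi x y : vec_state xi (x - y) = vec_state xi x - vec_state xi y.
Proof. by rewrite -scaleN1r addrC vec_stateL mulN1r addrC. Qed.

Lemma vec_state_star xi x : vec_state xi (star x) = conjc (vec_state xi x).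
Proof.
have [_ _ hS] := h_hom; rewrite /vec_state hS -cip_adj.
by rewrite /cip [ip (star (h x) _) _]adj_op [ip (star (h x) _) _]adj_op opJ.
Qed.

Lemma nrm_delta xi : nrm (cdelta R xi) = 1.
Proof.
by have := cip_delta R xi; rewrite /cip => -[d1 _]; rewrite /nrm [ip _ _]d1 sqrtr1.
Qed.

Lemma vec_state_bounded xi x : normc (vec_state xi x) <= 2 * nr x.
Proof.
have hx := star_hom_bop_bounded x (cdelta R xi) h_hom; rewrite nrm_delta mulr1 in hx.
apply: le_trans (normc_cip_le _ _) _.
by rewrite nrm_delta mulr1 ler_wpM2l.
Qed.

(** The elements with eigenvector delta_xi are closed under sums, products and limits. An
    eigenvector of an operator need not be one of its adjoint, so x and [star x] are tracked
    together; the generators are self-adjoint. *)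
Lemma hom_diagonal xi x : D x ->
  h x (cdelta R xi) = cscale (vec_state xi x) (cdelta R xi).
Proof.
have [hL hM hS] := h_hom.
pose E := [set x | exists c, h x (cdelta R xi) = cscale c (cdelta R xi)].
have Ecl : closed E.
  apply: closed_of_nr => z zE; exists (vec_state xi z).
  apply/subr0_eq/nrm_eq0/eqP; rewrite eq_le nrm_ge0 andbT.
  (* The constant is 1 + 2: contractivity of h and the factor 2 in [vec_state_bounded]. *)
  apply: (@le0_eps _ _ 3) => e /zE[d [c dc] zd].
  have dE := vec_state_eigen dc; rewrite -dE in dc.
  have hB : h (z - d) (cdelta R xi) = h z (cdelta R xi) - h d (cdelta R xi).
    by rewrite -(scaleN1r d) [z + _]addrC hL bopDE scaleN1r bopNE addrC.
  have -> : h z (cdelta R xi) - cscale (vec_state xi z) (cdelta R xi) =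
      h (z - d) (cdelta R xi) - cscale (vec_state xi (z - d)) (cdelta R xi).
    have -> : cscale (vec_state xi (z - d)) (cdelta R xi) =
        cscale (vec_state xi z) (cdelta R xi) - h d (cdelta R xi).
      rewrite vec_stateB cscaleDl dc -mulN1r -cscaleA cscaleN1 //.
    by rewrite hB opprB addrA subrK.
  apply: le_trans (nrmD _ _) _; rewrite nrmN nrm_cscale nrm_delta mulr1.
  have := star_hom_bop_bounded (z - d) (cdelta R xi) h_hom; rewrite nrm_delta mulr1.
  by have := vec_state_bounded xi (z - d); lra.
suff DE : D `<=` [set x | E x /\ E (star x)].
  by move=> /DE[[c hc] _]; rewrite (vec_state_eigen hc).
have E0 : E 0.
  exists 0; have := hL (-1) 0 0; rewrite !scaleN1r oppr0 addr0 => ->.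
  by rewrite addNr /cscale !scale0r addr0.
have EL c y z : E y -> E z -> E (c *: y + z).
  move=> [a ya] [b zb]; exists (c * a + b).
  rewrite hL bopDE bopZE ya zb cscaleA -cscaleDl.
  reflexivity.
have EM y z : E y -> E z -> E (y ** z).
  move=> [a ya] [b zb]; exists (b * a).
  rewrite hM bopME zb op_cscale ya cscaleA.
  reflexivity.
apply: smallest_sub.
  split.
  - apply: closedI => //; apply: closed_of_nr => z zE /=.
    apply: closed_nr => // e /zE[d Ed zd]; exists (star d) => //.
    by rewrite -starN -starD nr_star.
  - by split=> //; rewrite star0.
  - by move=> c y z [Ey Ey'] [Ez Ez']; split; [exact: EL|rewrite starD starZ; exact: EL].
  - by move=> y z [Ey Ey'] [Ez Ez']; split; [exact: EM|rewrite starM; exact: EM].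
  - by move=> y [Ey Ey']; split=> //; rewrite starK.
move=> _ [w [X [lw Xw ->]]].
have [X0|X0] := pselect (X !=set0); last first.
  move/set0P/negP/negPn/eqP: X0 => ->.
  by rewrite (sandwich_set0 rep); split=> //; rewrite star0.
have EX : idem (Some (w, X)) by exact/idemP.
have EvX : E (ev (Some (w, X))) by eexists; exact: hom_idem_val_delta.
by split=> //; rewrite (star_idem_val rep EX).
Qed.

Lemma vec_state_char xi : char_on D (vec_state xi).
Proof.
have [_ hM _] := h_hom; split=> [c x y _ _|x y Dx Dy|x _].
- exact: vec_stateL.
- apply: vec_state_eigen; rewrite hM bopME [h y _]hom_diagonal // op_cscale hom_diagonal //.
  by rewrite cscaleA mulrC.
- exact: vec_state_star.
Qed.

Lemma vec_state_idem_val xi (x : preidem L) : idem x ->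
  vec_state xi (ev x) = if `[< val xi x >] then 1 else 0.
Proof. by move=> Ex; apply: vec_state_eigen; exact: hom_idem_val_delta. Qed.

Lemma tight_spectrum_locally_const (x : preidem L) (xi : tight_spectrum L) : idem x ->
  nbhs xi [set eta : tight_spectrum L | (x \in val eta) = (x \in val xi)].
Proof.
move=> Ex.
have c : continuous (fun eta : tight_spectrum L => x \in val eta).
  have := @continuous_comp _ _ _ (@indicator L : tight_spectrum L -> _)
    (@proj (@idem L) (fun=> bool) (SigSub (mem_set Ex))).
  move=> cc eta; apply: cc; [exact: initial_continuous|exact: proj_continuous].
exact: (c xi _ (discrete_set1 _)).
Qed.

(** On a generator the function of xi is locally constant. The bound of [vec_state_bounded] is the
    same for all xi, so norm limits in the algebra become uniform limits of functions, which
    preserve continuity. *)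
Lemma vec_state_continuous x : D x ->
  continuous (vec_state^~ x : tight_spectrum L -> R[i]^o).
Proof.
have sD : cstar_subalgebra D := diagonal_subalgebra p s.
have [_ D0 DL DM DS] := sD.
have [K KE] : exists K : set A, forall z,
    K z <-> continuous (vec_state^~ z : tight_spectrum L -> R[i]^o).
  by exists [set z | continuous (vec_state^~ z : tight_spectrum L -> R[i]^o)].
(* Budget of the three-term estimate: replacing z by d costs 2 e / 5 at each of the two filters, and
   continuity at d costs e / 5. *)
have arith (e r n1 n2 n3 n4 n5 : R) : n1 <= n2 + n3 -> n3 <= n4 + n5 ->
    n2 <= 2 * r -> n5 <= 2 * r -> n4 <= e / 5 -> r <= e / 5 -> n1 <= e by lra.
have Kcl : closed K.
  apply: closed_of_nr => z zK; apply/KE/continuous_normcP => xi e e0.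
  have e50 : 0 < e / 5 by rewrite divr_gt0.
  have [d /KE/continuous_normcP Kd zd] := zK _ e50.
  apply: filterS (Kd xi _ e50) => eta /= dd.
  rewrite -[leLHS]/(normc (vec_state xi z - vec_state eta z)).
  have xid := vec_state_bounded xi (z - d); have etad := vec_state_bounded eta (d - z).
  rewrite vec_stateB in xid; rewrite vec_stateB (nrB d z) in etad.
  apply: (arith _ _ _ _ _ _ _ (normc_triangle _ _ _) _ xid etad dd zd).
  exact: (normc_triangle (vec_state xi d) (vec_state eta d) (vec_state eta z)).
suff DK : D `<=` [set x | D x /\ (K x /\ K (star x))] by move=> /DK[_ [/KE]].
have K0 : K 0.
  apply/KE; rewrite (_ : vec_state^~ 0 = fun=> 0); first exact: cst_continuous.
  by apply/funext => xi; rewrite (char_on0 sD (vec_state_char xi)).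
have KL c y z : K y -> K z -> K (c *: y + z).
  move=> /KE Ky /KE Kz; apply/KE.
  rewrite (_ : vec_state^~ _ = fun xi => c * vec_state xi y + vec_state xi z).
    exact: continuous_linear_comb Ky Kz.
  by apply/funext => xi; exact: vec_stateL.
have KM y z : D y -> D z -> K y -> K z -> K (y ** z).
  move=> Dy Dz /KE Ky /KE Kz; apply/KE.
  rewrite (_ : vec_state^~ _ = fun xi => vec_state xi y * vec_state xi z).
    exact: continuous_mul Ky Kz.
  by apply/funext => xi; have [_ hM _] := vec_state_char xi; exact: hM.
have [cD _ _ _ _] := sD.
apply: smallest_sub.
  split.
  - apply: closedI => //; apply: closedI => //; apply: closed_of_nr => z zK /=.
    apply: (closed_nr Kcl) => e /zK[d Kd zd]; exists (star d) => //.
    by rewrite -starN -starD nr_star.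
  - by split=> //; split=> //; rewrite star0.
  - move=> c y z [Dy [Ky Ky']] [Dz [Kz Kz']]; split; first exact: DL.
    by split; [exact: KL|rewrite starD starZ; exact: KL].
  - move=> y z [Dy [Ky Ky']] [Dz [Kz Kz']]; split; first exact: DM.
    by split; [exact: KM|rewrite starM; apply: KM => //; exact: DS].
  - by move=> y [Dy [Ky Ky']]; split; [exact: DS|split=> //; rewrite starK].
move=> x' Gx; split; first by move=> B [_]; exact.
case: Gx => w [X [lw Xw ->]].
have [X0|X0] := pselect (X !=set0); last first.
  move/set0P/negP/negPn/eqP: X0 => ->.
  by rewrite (sandwich_set0 rep); split=> //; rewrite star0.
have EX : idem (Some (w, X)) by exact/idemP.
have KX : K (ev (Some (w, X))).
  apply/KE/continuous_normcP => xi e e0.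
  apply: filterS (tight_spectrum_locally_const xi EX) => eta /= exi.
  have exi' : `[< val eta (Some (w, X)) >] = `[< val xi (Some (w, X)) >] := exi.
  rewrite -[leLHS]/(normc (vec_state xi (ev (Some (w, X))) - vec_state eta (ev (Some (w, X))))).
  by rewrite !(vec_state_idem_val _ EX) exi' subrr normc0 ltW.
by split=> //; rewrite (star_idem_val rep EX).
Qed.

End DiagonalStates.

Lemma locally_constant_continuous (Y : topologicalType) (f : Y -> bool) :
  (forall y, nbhs y [set z | f z = f y]) -> continuous f.
Proof. by move=> fY y; apply/discrete_cvg; exact: fY. Qed.

(** * Characters as functions on the ambient algebra *)

Section CharacterExtension.
Variables (R : realType) (A : cstarAlgType R) (D : set A).
Hypothesis sD : cstar_subalgebra D.
Implicit Types chi : set_type (@characters R A D).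
Local Open Scope cstar_scope.

(** The value 0 outside D is a mere default, invisible to [char_on]. *)
Definition char_ext chi (x : A) : R[i] :=
  if pselect (D x) is left h then val chi (SigSub (mem_set h)) else 0.

Lemma char_extE chi (d : D) : char_ext chi (val d) = val chi d.
Proof.
rewrite /char_ext; case: pselect => [h|]; last by move: (set_mem (valP d)).
by congr (val chi _); exact: val_inj.
Qed.

Lemma char_ext_charP chi : char_on D (char_ext chi) /\ exists2 x, D x & char_ext chi x <> 0.
Proof.
have [_ _ DL DM DS] := sD.
have [[d chid] chiL chiM chiS] := set_mem (valP chi).
have E x (Dx : D x) : char_ext chi x = val chi (SigSub (mem_set Dx)).
  by rewrite -char_extE.
split; last by exists (val d); [exact: set_mem (valP d)|rewrite char_extE; exact/eqP].
split=> [c x y Dx Dy|x y Dx Dy|x Dx].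
- by rewrite (E _ (DL c x y Dx Dy)) (E _ Dx) (E _ Dy); exact: chiL.
- by rewrite (E _ (DM x y Dx Dy)) (E _ Dx) (E _ Dy); exact: chiM.
- by rewrite (E _ (DS x Dx)) (E _ Dx); exact: chiS.
Qed.

Lemma char_eval_continuous (d : D) :
  continuous ((fun chi => val chi d) : spectrum D -> R[i]^o).
Proof.
move=> chi.
apply: (@continuous_comp _ _ _ (set_val : spectrum D -> {ptws D -> R[i]^o})
  (@proj D (fun=> R[i]^o) d)).
  exact: initial_continuous.
exact: proj_continuous.
Qed.

End CharacterExtension.

Theorem theorem6p9 (R : realType) (L : labelledSpace)
  (wlr : weakly_left_resolving L) (relc : closed_rel_complements L)
  (A : cstarAlgType R) (p : set (vertex L) -> A) (s : alphabet L -> A)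
  (univ : universal_representation p s) :
  homeomorphic (tight_spectrum L) (spectrum (diagonal_algebra p s)).
Proof.
have [rep _ univ_hom] := univ.
have [h [h_hom hp hs]] := univ_hom _ _ _ (tight_representation R wlr relc).
pose D := diagonal_algebra p s.
have sD : cstar_subalgebra D := diagonal_subalgebra p s.
pose vs := vec_state h.
have vsE xi x : idem x -> vs xi (idem_val p s x) = if `[< val xi x >] then 1 else 0.
  exact: (vec_state_idem_val h_hom hp hs).
have vsC xi : char_on D (vs xi) := vec_state_char rep h_hom hp hs xi.
have f_char xi : @characters R A D (fun d : D => vs xi (val d)).
  have [vL vM vS] := vsC xi; have DP (d : D) : D (val d) := set_mem (valP d).
  split=> [|c x y z ->|x y z ->|x z ->]; [|exact: vL|exact: vM|exact: vS].
  (* The character is non-zero because it takes the value 1 at any member of the non-empty filter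
     xi. *)
  have [[xiE [x xix] _ _ _] _] := tightP xi; have Ex := xiE _ xix.
  exists (SigSub (mem_set (@idem_val_diagonal R L A p s x Ex))).
  by rewrite /= (vsE _ _ Ex) asboolT // oner_eq0.
pose f (xi : tight_spectrum L) : spectrum D := SigSub (mem_set (f_char xi)).
have g_tight (chi : spectrum D) : tight_filters (char_filter p s (char_ext chi)).
  have [cchi chi0] := char_ext_charP sD chi.
  exact: (char_filter_tight wlr relc rep).
pose g (chi : spectrum D) : tight_spectrum L := mk_tight (g_tight chi).
have fE xi x : D x -> char_ext (f xi) x = vs xi x.
  by move=> Dx; rewrite (char_extE (f xi) (SigSub (mem_set Dx))).
have fK : cancel f g.
  move=> xi; apply: val_inj; apply/seteqP; split=> x.
    case=> Ex; rewrite fE; last exact: idem_val_diagonal.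
    by rewrite vsE //; case: asboolP => // _ /eqP; rewrite eq_sym oner_eq0.
  have [[xiE _ _ _ _] _] := tightP xi => xix; have Ex := xiE _ xix.
  split=> //; rewrite fE; last exact: idem_val_diagonal.
  by rewrite vsE // asboolT.
have gK : cancel g f.
  move=> chi; apply: val_inj; apply/funext => d; rewrite /= -char_extE.
  have [cchi _] := char_ext_charP sD chi.
  (* Two characters are compared on generators, where both take values in {0, 1} and take the value
     1 on the same ones. *)
  apply: (char_generated_eq (vsC _) cchi); last exact: set_mem (valP d).
  move=> _ [w [X [lw Xw ->]]].
  have [X0|X0] := pselect (X !=set0); last first.
    move/set0P/negP/negPn/eqP: X0 => ->; rewrite (sandwich_set0 rep).
    by rewrite (char_on0 sD (vsC _)) (char_on0 sD cchi).
  have EX : idem (Some (w, X)) by exact/idemP.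
  rewrite (vsE _ _ EX); case: asboolP => [[_ ->]//|nX].
  apply/esym; apply: contrapT => X1; apply: nX; split=> //.
  exact: (char_idem_val01 wlr relc rep cchi EX).
exists f, g; split=> //.
  apply: initial_topology_continuous; apply: ptws_continuous => d.
  exact: (@vec_state_continuous R L wlr relc A p s rep h h_hom hp hs (val d) (set_mem (valP d))).
apply: initial_topology_continuous; apply: ptws_continuous => -[x xE].
apply: locally_constant_continuous => chi.
have Ex : idem x := set_mem xE.
have Dx : D (idem_val p s x) := idem_val_diagonal Ex.
have val01 (chi0 : spectrum D) :
    char_ext chi0 (idem_val p s x) = 0 \/ char_ext chi0 (idem_val p s x) = 1.
  have [cchi0 _] := char_ext_charP sD chi0.
  have [|n0] := pselect (char_ext chi0 (idem_val p s x) = 0); first by left.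
  by right; exact: (char_idem_val01 wlr relc rep cchi0 Ex).
(* The radius 1/2 separates the only possible values 0 and 1, so membership of x in the filter is
   locally constant in the character. *)
have /continuous_normcP/(_ chi 2^-1) := @char_eval_continuous R A D (SigSub (mem_set Dx)).
rewrite invr_gt0 => /(_ (ltr0Sn _ _)); apply: filterS => chi' /=.
rewrite -!char_extE /= => near_chi.
have eq_val : char_ext chi' (idem_val p s x) = char_ext chi (idem_val p s x).
  move: near_chi; have n1 : (1 : R) <= 2^-1 -> False by move=> ?; lra.
  case: (val01 chi) => ->; case: (val01 chi') => -> //.
    by rewrite sub0r /= oppr0 expr0n addr0 sqrrN expr1n sqrtr1 => /n1.
  by rewrite subr0 normc1 => /n1.
by apply/asboolP/asboolP => -[_ v1]; split=> //; rewrite -v1 eq_val.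
Qed.
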